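(* Let $d\ge 3$ be an integer and let $\mu$ and $\rho$ be Borel probability measures on $\mathbb R$ with $\int_{\mathbb R}|x|^d\,\mu(dx)<\infty$ and $\int_{\mathbb R}|x|^d\,\rho(dx)<\infty$. Suppose that $$\liminf_{n\to\infty}\frac{\log\Delta(\mu^{n\boxplus},\rho^{n\boxplus})}{\sqrt n}=-\beta<0$$ for a positive real number $\beta$. Then $$\varphi(t;\mu)=\varphi(t;\rho)\quad\text{for all } t\in\Big[-\frac{\beta}{300\sqrt{m_2(\mu)-m_1^2(\mu)}},\ \frac{\beta}{300\sqrt{m_2(\mu)-m_1^2(\mu)}}\Big].$$
   Context: $\boxplus$ denotes the free additive convolution of Borel probability measures on $\mathbb R$, and $\mu^{n\boxplus}=\mu\boxplus\dots\boxplus\mu$ ($n$ times). The Kolmogorov distance is $\Delta(\mu,\nu)=\sup_{x\in\mathbb R}|\mu((-\infty,x))-\nu((-\infty,x))|$. Convention: $\log 0=-\infty$. Moments: $m_s(\mu)=\int_{\mathbb R}u^s\,\mu(du)$. Characteristic function: $\varphi(t;\mu)=\int_{\mathbb R}e^{itx}\,\mu(dx)$. *)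

(* Defs.v *)
From HB Require Import structures.
From mathcomp Require Import all_boot all_order all_algebra.
From mathcomp Require Import complex.
From mathcomp Require Import all_classical all_reals all_analysis.

Set Implicit Arguments.
Unset Strict Implicit.
Unset Printing Implicit Defensive.

Import Order.TTheory GRing.Theory Num.Theory.
Import numFieldNormedType.Exports.

Local Open Scope classical_set_scope.
Local Open Scope ring_scope.
Local Open Scope complex_scope.

Definition borel_prob (R : realType) := probability (measurableTypeR R) R.

Section Defs.
Variable R : realType.
Implicit Types (mu nu lam : borel_prob R) (z : R[i]).

Definition complex_integral mu (f : R -> R[i]) : R[i] :=
  (\int[mu]_x complex.Re (f x)) +i* (\int[mu]_x complex.Im (f x)).

Definition char_fun mu (t : R) : R[i] :=
  complex_integral mu (fun x => cos (t * x) +i* sin (t * x)).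

Definition moment mu (s : nat) : R := \int[mu]_x (x ^+ s).

(* Distribution functions are the left-continuous ones, x |-> mu(]-oo, x[);
   the supremum lies in [0, 1]. *)
Definition kolmogorov mu nu : \bar R :=
  ereal_sup [set `|mu `]-oo, x[%classic - nu `]-oo, x[%classic|%E | x in [set: R]].

Definition cauchy_transform mu z : R[i] :=
  complex_integral mu (fun x => (z - x%:C)^-1).

Definition recip_cauchy mu z : R[i] := (cauchy_transform mu z)^-1.

Definition stolz (a b : R) : set (R[i]) :=
  [set z | b < complex.Im z /\ `|complex.Re z| < a * complex.Im z].

(* phi is a Voiculescu transform of mu on the truncated cone [stolz a b], i.e.
   phi(z) = F^{-1}(z) - z with F = [recip_cauchy mu].  On a cone, F may have
   several right inverses with values in the upper half-plane; the condition
   phi(z) = o(|z|) at infinity singles out the one used by Bercovici and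
   Voiculescu. *)
Definition is_voiculescu mu (a b : R) (phi : R[i] -> R[i]) : Prop :=
  (forall z, stolz a b z ->
     0 < complex.Im (z + phi z) /\ recip_cauchy mu (z + phi z) = z) /\
  (forall e : R, 0 < e -> exists M : R, forall z, stolz a b z ->
     M < complex.Im z -> `|phi z| <= e%:C * `|z|).

(* lam is the free additive convolution of mu and nu (Bercovici-Voiculescu):
   on some truncated cone the Voiculescu transforms of mu and nu exist and their
   sum is the Voiculescu transform of lam.  Such a measure lam always exists and
   is unique, since a Voiculescu transform near infinity determines the measure. *)
Definition is_free_conv mu nu lam : Prop :=
  exists (a b : R) (phi psi : R[i] -> R[i]),
    [/\ 0 < a, 0 < b, is_voiculescu mu a b phi, is_voiculescu nu a b psi &
        is_voiculescu lam a b (fun z => phi z + psi z)].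

Inductive is_free_power mu : nat -> borel_prob R -> Prop :=
| free_power1 : is_free_power mu 1 mu
| free_powerS n nu lam :
    is_free_power mu n nu -> is_free_conv nu mu lam -> is_free_power mu n.+1 lam.

End Defs.

(* Main.v *)
Require Import Defs.
From HB Require Import structures.
From mathcomp Require Import all_boot all_order all_algebra.
From mathcomp Require Import complex.
From mathcomp Require Import all_classical all_reals all_analysis.
From mathcomp Require Import cyclic separable cyclotomic measurable_realfun.
From mathcomp Require Import ring lra zify.
Import Order.TTheory GRing.Theory Num.Theory.
Import numFieldNormedType.Exports.
Import ComplexField.Normc.
Local Open Scope classical_set_scope.
Local Open Scope ring_scope.
Local Open Scope complex_scope.
Set Implicit Arguments.
Unset Strict Implicit.
Unset Printing Implicit Defensive.

(** Write G for the Cauchy transform of [mu], F = 1/G, and s for the standard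
    deviation of [mu]. Free powers are subordinated: for z in the upper half-plane
    F_n(z) = F(Z(z)), where n Z(z) = z + (n-1) F_n(z) and F_n belongs to the n-th
    free power. The Voiculescu transforms give this at points near i*infinity, and
    it extends to the half-plane by the identity theorem. Conversely
    H(Z) = n Z - (n-1) F(Z) is injective with H(Z) well inside the upper half-plane
    as soon as Im Z > 10 s sqrt n, so that G_n(H(Z)) = G(Z) there.
    If the n-th powers of [mu] and [rho] are at Kolmogorov distance delta, their
    Cauchy transforms at z differ by O(delta / Im z); through subordination,
    G_mu - G_rho = O(delta / Y) on the circle of centre iY and radius Y/2, with
    Y ~ 20 s sqrt n. Hence the k-th Taylor coefficient of G_mu - G_rho at iY is
    O(delta 2^k Y^(-k-1)). Up to a unimodular factor Y^(-k-1), it is the integral of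
    (1 + ix/Y)^(-k-1) against mu - rho, and for k+1 = tY this kernel tends to
    exp(-itx) (Post-Widder). With delta <= exp(- beta sqrt n / 2) and
    t <= beta / (300 s), the bound delta 2^k tends to 0. *)

(** Only [mu] is inverted. At z = H(Z) the subordination point of the power of [mu] is exactly Z;
    that of the power of [rho] is some W at distance O(Y^2 |G_n - G'_n|) from Z, where G_n and G'_n
    are the Cauchy transforms of the two powers at z, and the Lipschitz constant O(Y^(-2)) of the
    Cauchy transform of [rho] absorbs this. Hence s is the deviation of [mu] alone. Since H
    multiplies F by about n, F(Z) must be known up to O(Im Z / n). Centring at the mean m gives F(Z)
    = Z - m + O(s^2 / Im Z), and this forces Im Z to be of order s sqrt n. The budget follows: k is
    about 20 s t sqrt n, at most beta sqrt n / 15, so 2^k <= e^k is far below 1/delta >= exp(beta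
    sqrt n / 2). The liminf provides such a delta for infinitely many n only; that is enough,
    because the characteristic functions compared do not depend on n. *)

Section Modulus.
Context {R : realType}.
Implicit Types (z w : R[i]) (x y r : R).

Lemma normc_ge0 z : 0 <= normc z.
Proof. by case: z => a b; apply: sqrtr_ge0. Qed.

Lemma normcD z w : normc (z + w) <= normc z + normc w.
Proof. exact: (@le_normcD R z w). Qed.

Lemma normcN z : normc (- z) = normc z.
Proof. exact: (@normcN R z). Qed.

Lemma normcB z w : normc (z - w) <= normc z + normc w.
Proof. by rewrite -[normc w]normcN normcD. Qed.

Lemma normcC z w : normc (z - w) = normc (w - z).
Proof. by rewrite -normcN opprB. Qed.

Lemma normc_triangle v z w : normc (z - w) <= normc (z - v) + normc (v - w).
Proof. by apply: le_trans (normcD _ _); rewrite addrA subrK. Qed.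

Lemma normc_rev z w : normc z - normc w <= normc (z - w).
Proof. by rewrite lerBlDr -{1}(subrK w z) normcD. Qed.

Lemma normcX z n : normc (z ^+ n) = normc z ^+ n.
Proof. by elim: n => [|n IH]; rewrite ?expr0 ?normc1 // !exprS normcM IH. Qed.

Lemma normc_eq0 z : (normc z == 0) = (z == 0).
Proof. by apply/eqP/eqP => [/eq0_normc //|->]; rewrite normc0. Qed.

Lemma normc_gt0 z : (0 < normc z) = (z != 0).
Proof. by rewrite lt_neqAle normc_ge0 andbT eq_sym normc_eq0. Qed.

Lemma normc_real x : normc x%:C = `|x|.
Proof. by rewrite /normc /= expr0n /= addr0 sqrtr_sqr. Qed.

Lemma normcE z : normc z = Num.sqrt (complex.Re z ^+ 2 + complex.Im z ^+ 2).
Proof. by case: z. Qed.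

Lemma normc_sqr z : normc z ^+ 2 = complex.Re z ^+ 2 + complex.Im z ^+ 2.
Proof. by rewrite normcE sqr_sqrtr // addr_ge0 ?sqr_ge0. Qed.

Lemma normc_norm z : `|z| = (normc z)%:C.
Proof. by rewrite normc_def normcE. Qed.

Lemma Re_le_normc z : `|complex.Re z| <= normc z.
Proof. by rewrite normcE -sqrtr_sqr ler_wsqrtr // lerDl sqr_ge0. Qed.

Lemma Im_le_normc z : `|complex.Im z| <= normc z.
Proof. by rewrite normcE -sqrtr_sqr ler_wsqrtr // lerDr sqr_ge0. Qed.

Lemma normc_le_ReIm z : normc z <= `|complex.Re z| + `|complex.Im z|.
Proof.
rewrite -(ler_pXn2r (ltn0Sn 1)) ?nnegrE ?normc_ge0 ?addr_ge0 //.
rewrite normc_sqr ?real_normK ?num_real //.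
rewrite sqrrD !real_normK ?num_real // addrAC lerDl.
by rewrite mulrn_wge0 // mulr_ge0.
Qed.

Lemma normc_sum (I : Type) (s : seq I) (P : pred I) (f : I -> R[i]) :
  normc (\sum_(i <- s | P i) f i) <= \sum_(i <- s | P i) normc (f i).
Proof.
elim/big_rec2: _ => [|i x z Pi le_zx]; first by rewrite normc0.
by apply: le_trans (normcD _ _) _; rewrite lerD2l.
Qed.

Lemma normc_unity z n : (0 < n)%N -> z ^+ n = 1 -> normc z = 1.
Proof.
move=> n0 zn; apply/eqP; rewrite -(pexpr_eq1 n0 (normc_ge0 z)).
by rewrite -normcX zn normc1.
Qed.

End Modulus.

(** * Cauchy estimates for polynomial coefficients *)

Section PolyBounds.
Context {R : realType}.
Implicit Types (p q : {poly R[i]}) (r S : R).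

(** X^n - 1 splits and is separable, so it has n distinct roots, and a full set of n-th roots of
    unity contains a primitive one. *)
Lemma complex_prim_root n : (0 < n)%N ->
  exists w : R[i], n.-primitive_root w.
Proof.
move=> n0; pose p : {poly R[i]} := 'X^n - 1.
have [r Dp] := closed_field_poly_normal p.
have p_monic : p \is monic by rewrite /p monicXnsubC.
rewrite (monicP p_monic) scale1r in Dp.
have sz_r : size r = n.
  by apply: succn_inj; rewrite -(size_prod_XsubC _ id) -Dp size_XnsubC.
have r_root : all n.-unity_root r.
  by apply/allP => z zr; rewrite /root_of_unity -/p Dp root_prod_XsubC.
have uniq_r : uniq r.
  rewrite -separable_prod_XsubC -Dp; apply: separable_Xn_sub_1.
  by rewrite pnatr_eq0 -lt0n.
have /hasP[w _ wn] := has_prim_root n0 r_root uniq_r (eq_leq (esym sz_r)).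
by exists w.
Qed.

Lemma prim_root_sum n (w : R[i]) (m : nat) : n.-primitive_root w -> ~~ (n %| m)%N ->
  \sum_(j < n) w ^+ (m * j) = 0.
Proof.
move=> wn nm.
have wm1 : w ^+ m != 1 by rewrite -(prim_order_dvd wn).
apply: (mulfI (_ : w ^+ m - 1 != 0)); first by rewrite subr_eq0.
under eq_bigr do rewrite exprM.
by rewrite mulr0 -subrX1 -exprM mulnC exprM (prim_expr_order wn) expr1n subrr.
Qed.

(* Averaging p over the N-th roots of unity times r^k, N > deg p, isolates the
   k-th coefficient: a discrete substitute for Cauchy's estimate. *)
Lemma coef_le_circle p r S : 0 < r -> (forall h, normc h = r -> normc p.[h] <= S) ->
  forall k, normc p`_k * r ^+ k <= S.
Proof.
move=> r0 pS k.
have S0 : 0 <= S.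
  by apply: le_trans (normc_ge0 _) (pS r%:C _); rewrite normc_real gtr0_norm.
case: (ltnP k (size p)) => [kp|pk]; last by rewrite nth_default // normc0 mul0r.
set N := size p in kp *; have N0 : (0 < N)%N by apply: leq_ltn_trans kp.
have [w wN] := complex_prim_root N0.
have w1 : normc w = 1 by apply: (normc_unity N0); rewrite prim_expr_order.
(* The weight is w^(-kj), written with a natural exponent. *)
have E : N%:R * (p`_k * r%:C ^+ k) =
  \sum_(j < N) w ^+ ((N - k) * j) * p.[w ^+ j * r%:C].
  under eq_bigr do rewrite horner_coef mulr_sumr.
  rewrite exchange_big /= (bigD1 (Ordinal kp)) //= [X in _ + X]big1 ?addr0.
    transitivity (\sum_(j < N) p`_k * r%:C ^+ k).
      by rewrite sumr_const card_ord mulr_natl.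
    apply: eq_bigr => j _; rewrite exprMn mulrCA [w ^+ _ * (_ * _)]mulrA -exprM -exprD.
    by rewrite [(j * k)%N]mulnC -mulnDl subnK 1?ltnW // [w ^+ (N * j)]exprM (prim_expr_order wN) expr1n mul1r.
  move=> i ik; rewrite (eq_bigr (fun j : 'I_N => p`_i * r%:C ^+ i * w ^+ ((N - k + i) * j))).
    rewrite -mulr_sumr (prim_root_sum wN) ?mulr0 //.
    (* N - k + i lies strictly between 0 and 2N, so it is a multiple of N only if it equals N, that
       is i = k. *)
    apply: contra ik => /dvdnP[c Ec]; apply/eqP/val_inj => /=.
    by case: c Ec => [|[|c]]; rewrite ?mulSn; have := ltn_ord i; lia.
  move=> j _; rewrite exprMn -exprM mulnDl exprD [(i * j)%N]mulnC; ring.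
have N1 : normc (N%:R : R[i]) = N%:R.
  have -> : (N%:R : R[i]) = (N%:R : R)%:C by rewrite rmorph_nat.
  by rewrite normc_real ger0_norm.
rewrite -(ler_pM2l (_ : 0 < N%:R)) ?ltr0n //.
have -> : N%:R * (normc p`_k * r ^+ k) = normc (N%:R * (p`_k * r%:C ^+ k)).
  by rewrite !normcM normcX normc_real N1 gtr0_norm.
rewrite E; apply: le_trans (normc_sum _ _ _) _.
rewrite mulr_natl -[X in _ <= S *+ X]card_ord -sumr_const; apply: ler_sum => j _.
rewrite normcM normcX w1 expr1n mul1r; apply: pS.
by rewrite normcM normcX w1 expr1n mul1r normc_real gtr0_norm.
Qed.

Lemma sum_half_lt2 n : \sum_(i < n) (2^-1 : R) ^+ i <= 2.
Proof.
have := subrX1 (2^-1 : R) n; have : 0 <= (2^-1 : R) ^+ n by rewrite exprn_ge0.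
by lra.
Qed.

(** The coefficients of [p] are those of X^N p, shifted by N, so Cauchy's estimate bounds the k-th
    one by S r^(-N-k). On the half disc the resulting geometric series sums to at most 2. *)
Lemma poly_le_half_disc p N r S : 0 < r ->
  (forall h, normc h <= r -> normc (h ^+ N * p.[h]) <= S) ->
  forall h, normc h <= r / 2 -> normc p.[h] <= 2 * S / r ^+ N.
Proof.
move=> r0 pS h hr.
have S0 : 0 <= S by apply: le_trans (normc_ge0 _) (pS 0 _); rewrite normc0 ltW.
have coefS k : normc p`_k * r ^+ k <= S / r ^+ N.
  rewrite ler_pdivlMr ?exprn_gt0 // -mulrA -exprD.
  have := @coef_le_circle ('X^N * p) r S r0 _ (k + N)%N.
  rewrite coefXnM ltnNge leq_addl /= addnK; apply=> z zr.
  by rewrite hornerM hornerXn pS ?zr.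
rewrite horner_coef; apply: le_trans (normc_sum _ _ _) _.
apply: (@le_trans _ _ (\sum_(i < size p) S / r ^+ N * (2^-1) ^+ i)).
  apply: ler_sum => i _; rewrite normcM normcX.
  apply: (@le_trans _ _ (normc p`_i * (r ^+ i * 2^-1 ^+ i))).
    by rewrite ler_wpM2l ?normc_ge0 // -exprMn lerXn2r // nnegrE ?normc_ge0 ?mulr_ge0 ?invr_ge0 ?(ltW r0).
  by rewrite mulrA ler_wpM2r ?exprn_ge0.
rewrite -mulr_sumr (_ : 2 * S / r ^+ N = S / r ^+ N * 2); last by rewrite [RHS]mulrC mulrA.
rewrite ler_wpM2l ?sum_half_lt2 //.
by rewrite divr_ge0 ?exprn_ge0 // ltW.
Qed.

End PolyBounds.

(** * Uniform limits of polynomials and the identity theorem *)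

(* Being a uniform limit of polynomials on the disc |h| <= r stands in for
   holomorphy near the disc; it is visibly stable under sums, products and
   composition. *)
Definition papprox {R : realType} (f : R[i] -> R[i]) (r : R) :=
  forall e : R, 0 < e ->
    exists p : {poly R[i]}, forall h, normc h <= r -> normc (f h - p.[h]) <= e.

Section PolynomialApproximation.
Context {R : realType}.
Implicit Types (f g : R[i] -> R[i]) (p q : {poly R[i]}) (r s e : R) (c h : R[i]).

Lemma poly_bounded_disc p r : exists2 M, 0 <= M &
  forall h, normc h <= r -> normc p.[h] <= M.
Proof.
exists (\sum_(i < size p) normc p`_i * `|r| ^+ i).
  by apply: sumr_ge0 => i _; rewrite mulr_ge0 ?normc_ge0 ?exprn_ge0.
move=> h hr; rewrite horner_coef; apply: le_trans (normc_sum _ _ _) _.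
apply: ler_sum => i _; rewrite normcM normcX ler_wpM2l ?normc_ge0 //.
by rewrite lerXn2r ?nnegrE ?normc_ge0 // (le_trans hr) ?ler_norm.
Qed.

Lemma horner_factor0 p : exists q, forall h, p.[h] = p.[0] + h * q.[h].
Proof.
elim/poly_ind: p => [|q c _]; last first.
  by exists q => h; rewrite !hornerMXaddC mulr0 add0r addrC mulrC.
by exists 0 => h; rewrite !horner0 mulr0 addr0.
Qed.

Lemma papprox_poly p r : papprox (fun h => p.[h]) r.
Proof. by move=> e e0; exists p => h _; rewrite subrr normc0 ltW. Qed.

Lemma papprox_eq f g r : (forall h, normc h <= r -> f h = g h) ->
  papprox f r -> papprox g r.
Proof. by move=> fg fr e /fr[p pP]; exists p => h hr; rewrite -fg // pP. Qed.

Lemma papprox_cst c r : papprox (fun=> c) r.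
Proof. by apply: papprox_eq (papprox_poly c%:P r) => h _; rewrite hornerC. Qed.

Lemma papprox_id r : papprox id r.
Proof. by apply: papprox_eq (papprox_poly 'X r) => h _; rewrite hornerX. Qed.

Lemma papprox_le f r s : s <= r -> papprox f r -> papprox f s.
Proof. by move=> sr fr e /fr[p pP]; exists p => h hs; rewrite pP // (le_trans hs). Qed.

Lemma papprox_bounded f r : papprox f r -> exists2 M, 0 <= M &
  forall h, normc h <= r -> normc (f h) <= M.
Proof.
move=> /(_ 1 ltr01)[p pP]; have [M M0 pM] := poly_bounded_disc p r.
exists (1 + M) => [|h hr]; first by rewrite addr_ge0.
by rewrite -(subrK p.[h] (f h)) (le_trans (normcD _ _)) // lerD ?pP ?pM.
Qed.

Lemma papproxD f g r : papprox f r -> papprox g r -> papprox (fun h => f h + g h) r.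
Proof.
move=> fr gr e e0; have e2 : 0 < e / 2 by rewrite divr_gt0.
have [[p pP] [q qP]] := (fr _ e2, gr _ e2); exists (p + q) => h hr.
rewrite hornerD opprD addrACA [leRHS]splitr (le_trans (normcD _ _)) //.
by rewrite lerD ?pP ?qP.
Qed.

Lemma papproxM f g r : papprox f r -> papprox g r -> papprox (fun h => f h * g h) r.
Proof.
move=> fr gr e e0.
have [M M0 fM] := papprox_bounded fr; have [N N0 gN] := papprox_bounded gr.
(* The bound 1 keeps the approximation of [g] below N + 1; the other makes the total error (M + N +
   1) d at most [e]. *)
pose d := Num.min 1 (e / (M + N + 1)).
have d0 : 0 < d by rewrite lt_min ltr01 divr_gt0 // ltr_wpDl // addr_ge0.
have [[p pP] [q qP]] := (fr _ d0, gr _ d0); exists (p * q) => h hr.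
have -> : f h * g h - (p * q).[h] = f h * (g h - q.[h]) + q.[h] * (f h - p.[h]).
  by rewrite hornerM; ring.
have qN : normc q.[h] <= N + 1.
  rewrite -[q.[h]](subrK (g h)) addrC (le_trans (normcD _ _)) // lerD ?gN //.
  by rewrite normcC (le_trans (qP _ hr)) // ge_min lexx.
apply: le_trans (normcD _ _) _; rewrite !normcM.
have H1 : normc (f h) * normc (g h - q.[h]) <= M * d.
  by apply: ler_pM; rewrite ?normc_ge0 ?fM ?qP.
have H2 : normc q.[h] * normc (f h - p.[h]) <= (N + 1) * d.
  by apply: ler_pM; rewrite ?normc_ge0 ?pP.
apply: le_trans (lerD H1 H2) _; rewrite -mulrDl addrA.
have MN : 0 < M + N + 1 by rewrite ltr_wpDl // addr_ge0.
by rewrite mulrC -ler_pdivlMr // /d ge_min lexx orbT.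
Qed.

Lemma papprox_horner p f r : papprox f r -> papprox (fun h => p.[f h]) r.
Proof.
move=> fr; elim/poly_ind: p => [|p c IH].
  by apply: papprox_eq (papprox_cst 0 r) => h _; rewrite horner0.
apply: papprox_eq (papproxD (papproxM IH fr) (papprox_cst c r)) => h _.
by rewrite hornerMXaddC.
Qed.

Lemma papprox_lim f r :
  (forall e, 0 < e -> exists2 g, papprox g r &
     forall h, normc h <= r -> normc (f h - g h) <= e) -> papprox f r.
Proof.
move=> fg e e0; have e2 : 0 < e / 2 by rewrite divr_gt0.
have [g gr fgP] := fg _ e2; have [p pP] := gr _ e2.
exists p => h hr; rewrite [leRHS]splitr.
by apply: le_trans (normc_triangle (g h) _ _) _; rewrite lerD ?fgP ?pP.
Qed.

Lemma papprox_comp g f c r s : papprox f r ->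
  (forall h, normc h <= r -> normc (f h - c) <= s) ->
  papprox (fun h => g (c + h)) s -> papprox (fun h => g (f h)) r.
Proof.
move=> fr fs gs; apply: papprox_lim => e /gs[p pP].
exists (fun h => p.[f h + - c]).
  by apply: papprox_horner; apply: papproxD fr (papprox_cst _ _).
by move=> h hr; have := pP _ (fs _ hr); rewrite [c + _]addrC subrK.
Qed.

Lemma papprox_cont f r : 0 < r -> papprox f r -> forall e, 0 < e ->
  exists s, [/\ 0 < s, s <= r & forall h, normc h <= s -> normc (f h - f 0) <= e].
Proof.
move=> r0 fr e e0; have e3 : 0 < e / 3 by rewrite divr_gt0.
have [p pP] := fr _ e3.
have [q pq] := horner_factor0 p.
have [M M0 qM] := poly_bounded_disc q r.
exists (Num.min r (e / 3 / (M + 1))); split.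
- by rewrite lt_min r0 /= divr_gt0 // ltr_wpDl.
- by rewrite ge_min lexx.
move=> h; rewrite le_min => /andP[hr hM].
have Hp : normc (p.[h] - p.[0]) <= e / 3.
  rewrite pq addrC addKr mulrC normcM (@le_trans _ _ (M * normc h)) ?ler_wpM2r ?normc_ge0 ?qM //.
  move: hM; rewrite ler_pdivlMr ?ltr_wpDl // mulrDr mulr1 mulrC.
  by apply: le_trans; rewrite lerDl normc_ge0.
have h0 : normc (p.[0] - f 0) <= e / 3.
  by rewrite normcC pP // normc0 ltW.
have := normc_triangle p.[h] (f h) (f 0); have := normc_triangle p.[0] p.[h] (f 0).
by have := pP _ hr; lra.
Qed.

Lemma geometric_expansion c h n : c != 0 -> c + h != 0 ->
  (c + h)^-1 - (\sum_(k < n) (- h) ^+ k / c ^+ k.+1) = (- h / c) ^+ n / (c + h).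
Proof.
move=> c0 ch0; apply: (mulIf ch0); rewrite mulrBl mulVf // mulfVK //.
have := subrX1 (- h / c) n; set S := \sum_(i < n) _ => ES.
have -> : \sum_(k < n) (- h) ^+ k / c ^+ k.+1 = c^-1 * S.
  rewrite mulr_sumr; apply: eq_bigr => k _.
  by rewrite exprMn exprS invfM mulrCA exprVn.
have -> : c^-1 * S * (c + h) = - ((- h / c - 1) * S).
  rewrite mulrAC mulrDr mulVf //; ring.
by rewrite -ES; ring.
Qed.

Lemma normc_half_ge c h : c != 0 -> normc h <= normc c / 2 ->
  normc c / 2 <= normc (c + h) /\ c + h != 0.
Proof.
move=> c0 hc; have c1 : 0 < normc c by rewrite normc_gt0.
have H : normc c / 2 <= normc (c + h).
  by have := normc_rev c (- h); rewrite normcN opprK; lra.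
by split=> //; rewrite -normc_gt0 (lt_le_trans _ H) // divr_gt0.
Qed.

Lemma geometric_remainder c h n : c != 0 -> normc h <= normc c / 2 ->
  normc ((c + h)^-1 - \sum_(k < n) (- h) ^+ k / c ^+ k.+1) <=
  2^-1 ^+ n * (2 / normc c).
Proof.
move=> c0 hc; have [ch ch0] := normc_half_ge c0 hc.
have c1 : 0 < normc c by rewrite normc_gt0.
rewrite geometric_expansion // normcM normcX normcV.
apply: ler_pM; rewrite ?exprn_ge0 ?invr_ge0 ?normc_ge0 //.
  rewrite lerXn2r ?nnegrE ?normc_ge0 ?invr_ge0 //.
  by rewrite normcM normcN normcV ler_pdivrMr // mulrC.
by rewrite -[2 / _]invrK invf_div lef_pV2 ?posrE ?divr_gt0 // (lt_le_trans _ ch) ?divr_gt0.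
Qed.

Lemma geometric_small (e : R) : 0 < e -> exists n, (2^-1 : R) ^+ n <= e.
Proof.
move=> e0.
have : (fun n => (2^-1 : R) ^+ n) @ \oo --> (0 : R).
  by apply: cvg_expr; rewrite ger0_norm ?invf_lt1 ?ltr1n.
move/cvgr0_norm_le => /(_ _ e0)[n _ /(_ n (leqnn n))] H; exists n.
by apply: le_trans H; exact: ler_norm.
Qed.

(** The partial sums of the geometric series of 1/(c + h) converge uniformly with ratio 1/2. *)
Lemma papprox_inv c : c != 0 -> papprox (fun h => (c + h)^-1) (normc c / 2).
Proof.
move=> c0 e e0; have c1 : 0 < normc c by rewrite normc_gt0.
have [n nP] := geometric_small (divr_gt0 e0 (divr_gt0 (ltr0Sn _ 1) c1)).
exists (\sum_(k < n) ((c ^- k.+1)%:P * (- 'X) ^+ k)) => h hc.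
rewrite horner_sum.
have -> : \sum_(k < n) ((c ^- k.+1)%:P * (- 'X) ^+ k).[h] =
          \sum_(k < n) (- h) ^+ k / c ^+ k.+1.
  by apply: eq_bigr => k _; rewrite hornerM hornerC horner_exp hornerN hornerX mulrC.
apply: le_trans (geometric_remainder n c0 hc) _.
by rewrite -ler_pdivlMr ?divr_gt0.
Qed.

(* Dividing by [h^N] costs only a factor [r^-N], because the coefficients of a
   polynomial are controlled on the full disc; so the zeros can be divided out
   indefinitely, and the factor [2^-N] left on a smaller disc kills [f]. *)
Lemma papprox_identity f r : 0 < r -> papprox f r ->
  (forall e, 0 < e -> exists h, [/\ h != 0, normc h <= e & f h = 0]) ->
  forall h, normc h <= r / 4 -> f h = 0.
Proof.
move=> r0 fr f0.
(* [f] is a uniform limit of polynomials divisible by h^N, for every N. *)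
have fN N : forall e, 0 < e -> exists p, forall h, normc h <= r ->
    normc (f h - h ^+ N * p.[h]) <= e.
  elim: N => [e /fr[p pP]|N IH e e0].
    by exists p => h /pP; rewrite mul1r.
  have e3 : 0 < e / 3 by rewrite divr_gt0.
  have [p pP] := IH _ e3.
  (* At a zero h of [f] the cofactor [p] is small. Compare it with the cofactor [q] of a far better
     approximation, whose precision may depend on h: q(h) is tiny since [f] vanishes at h, and p - q
     is controlled on the half disc. *)
  have H h : h != 0 -> normc h <= r / 2 -> f h = 0 -> normc p.[h] <= 2 * (e / 3) / r ^+ N.
    move=> h0 hr fh; apply/ler_addgt0Pr => d d0.
    have hN : 0 < normc h ^+ N by rewrite exprn_gt0 // normc_gt0.
    have rN : 0 < r ^+ N by rewrite exprn_gt0.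
    (* The first bound makes the contribution of [a] to p - q at most d/2; the second survives the
       division by |h|^N. *)
    pose a := Num.min (d * r ^+ N / 4) (d / 2 * normc h ^+ N).
    have a0 : 0 < a by rewrite lt_min !mulr_gt0.
    have [q qP] := IH _ a0.
    have hr' : normc h <= r by lra.
    have qh : normc q.[h] <= d / 2.
      have := qP _ hr'; rewrite fh sub0r normcN normcM normcX mulrC => qa.
      by rewrite -(ler_pM2r hN) (le_trans qa) // ge_min lexx orbT.
    have pq : normc (p - q).[h] <= 2 * (e / 3 + a) / r ^+ N.
      apply: (@poly_le_half_disc _ (p - q) N r) => // z zr.
      have -> : z ^+ N * (p - q).[z] = (f z - z ^+ N * q.[z]) - (f z - z ^+ N * p.[z]).
        by rewrite !hornerE; ring.
      by rewrite [e / 3 + a]addrC (le_trans (normcB _ _)) // lerD ?pP ?qP.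
    have aN : 2 * a / r ^+ N <= d / 2.
      have : a <= d * r ^+ N / 4 by rewrite ge_min lexx.
      by rewrite ler_pdivrMr //; lra.
    rewrite -[p.[h]](subrK q.[h]) -hornerN -hornerD (le_trans (normcD _ _)) //.
    move: pq; rewrite mulrDr mulrDl; lra.
  (* Zeros of [f] accumulate at 0 and [p] is continuous, so p(0) is small too; dropping it leaves
     one more factor h. *)
  have p0 : normc p.[0] <= 2 * (e / 3) / r ^+ N.
    apply/ler_addgt0Pr => d d0.
    have [s [s0 sr sP]] := papprox_cont r0 (papprox_poly p r) d0.
    have [|h [h0 hs fh]] := f0 (Num.min s (r / 2)); first by rewrite lt_min s0 divr_gt0.
    move: hs; rewrite le_min => /andP[hs hr].
    rewrite -[p.[0]](subrK p.[h]) addrC (le_trans (normcD _ _)) // lerD ?H //.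
    by rewrite normcC sP.
  have [q pq] := horner_factor0 p.
  exists q => h hr.
  have -> : f h - h ^+ N.+1 * q.[h] = (f h - h ^+ N * p.[h]) + h ^+ N * p.[0].
    by rewrite [p.[h]]pq exprSr; ring.
  apply: le_trans (normcD _ _) _; have := pP _ hr.
  suff : normc (h ^+ N * p.[0]) <= 2 * (e / 3) by lra.
  rewrite normcM normcX mulrC; apply: (@le_trans _ _ (normc p.[0] * r ^+ N)).
    by rewrite ler_wpM2l ?normc_ge0 // lerXn2r // nnegrE ?normc_ge0 ?ltW.
  by rewrite -ler_pdivlMr // exprn_gt0.
move=> h hr; apply: eq0_normc; apply/eqP; rewrite eq_le normc_ge0 andbT.
have [M M0 fM] := papprox_bounded fr.
apply/ler_addgt0Pr => e e0; rewrite add0r.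
have e2 : 0 < e / 2 by rewrite divr_gt0.
(* Makes 2^(-n) (2M + e), the bound for h^n p(h) on the half disc, at most e/2. *)
have eM : 0 < e / 4 / (M + e + 1) by rewrite divr_gt0 // ?divr_gt0 //; lra.
have [n nP] := geometric_small eM.
have [p pP] := fN n _ e2.
have hr' : normc h <= r by lra.
have hr2 : normc h <= r / 2 by lra.
have pB : normc p.[h] <= 2 * (M + e / 2) / r ^+ n.
  apply: poly_le_half_disc => // z zr.
  have -> : z ^+ n * p.[z] = f z - (f z - z ^+ n * p.[z]) by ring.
  by rewrite (le_trans (normcB _ _)) // lerD ?fM ?pP.
rewrite -(subrK (h ^+ n * p.[h]) (f h)) (le_trans (normcD _ _)) //.
suff : normc (h ^+ n * p.[h]) <= e / 2 by have := pP _ hr'; lra.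
rewrite normcM normcX.
apply: (@le_trans _ _ ((r / 2) ^+ n * (2 * (M + e / 2) / r ^+ n))).
  apply: ler_pM; rewrite ?exprn_ge0 ?normc_ge0 //.
  by rewrite lerXn2r // nnegrE ?normc_ge0 ?divr_ge0 ?ltW.
have -> : (r / 2) ^+ n * (2 * (M + e / 2) / r ^+ n) = (2^-1) ^+ n * (2 * (M + e / 2)).
  by rewrite exprMn; field; rewrite expf_neq0 ?gt_eqF.
have : (2^-1) ^+ n * (M + e + 1) <= e / 4 by rewrite -ler_pdivlMr //; lra.
have : 0 <= (2^-1 : R) ^+ n by rewrite exprn_ge0.
by set x := _ ^+ n; nra.
Qed.

End PolynomialApproximation.

(** * Cauchy transforms *)

Section ComplexIntegral.
Context {R : realType}.
Implicit Types (mu : borel_prob R) (f g : R -> R[i]) (u v : R -> R) (c z : R[i]).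

Definition rintegrable mu u := mu.-integrable [set: measurableTypeR R] (EFin \o u).

Lemma bounded_rintegrable mu u M :
  measurable_fun [set: measurableTypeR R] u -> (forall x, `|u x| <= M) ->
  rintegrable mu u.
Proof.
move=> mu_ uM; apply: measurable_bounded_integrable => //.
  by rewrite (le_lt_trans (probability_le1 mu measurableT)) ?ltry.
exists M; split; first by rewrite num_real.
by move=> N MN x _; apply: le_trans (uM x) (ltW MN).
Qed.

Lemma rintegrable_cst mu (r : R) : rintegrable mu (fun=> r).
Proof. by apply: (@bounded_rintegrable _ _ `|r|) => //; exact: measurable_cst. Qed.

Lemma Rintegral_prob_cst mu (r : R) : \int[mu]_x r = r.
Proof. rewrite Rintegral_cst // -[RHS]mulr1; congr (_ * _).
exact: (congr1 fine (probability_setT mu)). Qed.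

Lemma rintegrableD mu u v : rintegrable mu u -> rintegrable mu v ->
  rintegrable mu (fun x => u x + v x).
Proof.
by move=> iu iv; rewrite /rintegrable; apply: eq_integrable (integrableD _ iu iv).
Qed.

Lemma rintegrableZ mu u (r : R) : rintegrable mu u ->
  rintegrable mu (fun x => r * u x).
Proof.
by move=> iu; rewrite /rintegrable; apply: eq_integrable (integrableZl _ r iu).
Qed.

Lemma rintegrableN mu u : rintegrable mu u -> rintegrable mu (fun x => - u x).
Proof.
move=> /(rintegrableZ (-1)); rewrite /rintegrable; apply: eq_integrable => // x _.
by rewrite /= mulN1r.
Qed.

Lemma le_rintegrable mu u v : measurable_fun [set: measurableTypeR R] u ->
  (forall x, `|u x| <= v x) -> rintegrable mu v -> rintegrable mu u.
Proof.
move=> mu_ uv iv; apply: (le_integrable _ _ _ iv) => //.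
  exact/measurable_EFinP.
by move=> x _ /=; rewrite lee_fin (le_trans (uv x)) // ler_norm.
Qed.

Lemma Rintegral_norm_le mu u v : rintegrable mu u -> rintegrable mu v ->
  (forall x, `|u x| <= v x) -> `|\int[mu]_x u x| <= \int[mu]_x v x.
Proof.
move=> iu iv uv; apply: le_trans (le_normr_Rintegral _ iu) _ => //.
apply: le_Rintegral => //; exact: integrable_norm.
Qed.

Definition cmeasurable f :=
  measurable_fun [set: measurableTypeR R] (fun x => complex.Re (f x)) /\
  measurable_fun [set: measurableTypeR R] (fun x => complex.Im (f x)).

Definition cintegrable mu f :=
  rintegrable mu (fun x => complex.Re (f x)) /\
  rintegrable mu (fun x => complex.Im (f x)).

Lemma cmeasurable_cst c : cmeasurable (fun=> c).
Proof. by split; exact: measurable_cst. Qed.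

Lemma cmeasurableM f g : cmeasurable f -> cmeasurable g ->
  cmeasurable (fun x => f x * g x).
Proof.
move=> [f1 f2] [g1 g2]; split.
  apply: eq_measurable_fun (measurable_funB (measurable_funM f1 g1) (measurable_funM f2 g2)) => x _.
  by rewrite /=; case: (f x) (g x) => ? ? [].
apply: eq_measurable_fun (measurable_funD (measurable_funM f1 g2) (measurable_funM f2 g1)) => x _.
by rewrite /=; case: (f x) (g x) => ? ? [].
Qed.

Lemma cmeasurableX f n : cmeasurable f -> cmeasurable (fun x => f x ^+ n).
Proof.
move=> mf; elim: n => [|n IH]; first exact: cmeasurable_cst.
by have := cmeasurableM mf IH; under eq_fun do rewrite -exprS.
Qed.

Lemma cmeasurable_real u : measurable_fun [set: measurableTypeR R] u ->
  cmeasurable (fun x => (u x)%:C).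
Proof. by move=> mu_; split => //=; exact: measurable_cst. Qed.

Lemma cintegrable_le mu f v : cmeasurable f -> rintegrable mu v ->
  (forall x, normc (f x) <= v x) -> cintegrable mu f.
Proof.
move=> [m1 m2] iv fv; split; apply: le_rintegrable iv => // x;
  by rewrite (le_trans _ (fv x)) // ?Re_le_normc ?Im_le_normc.
Qed.

Lemma cintegrable_bounded mu f M : cmeasurable f ->
  (forall x, normc (f x) <= M) -> cintegrable mu f.
Proof. by move=> mf fM; apply: cintegrable_le fM => //; exact: rintegrable_cst. Qed.

Lemma cintegrable_cst mu c : cintegrable mu (fun=> c).
Proof. by split; exact: rintegrable_cst. Qed.

Lemma cintegral_cst mu c : complex_integral mu (fun=> c) = c.
Proof. by rewrite /complex_integral !Rintegral_prob_cst; case: c. Qed.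

Lemma eq_cintegral mu f g : (forall x, f x = g x) ->
  complex_integral mu f = complex_integral mu g.
Proof. by move=> fg; rewrite (_ : f = g) //; apply/funext. Qed.

Lemma cintegrableD mu f g : cintegrable mu f -> cintegrable mu g ->
  cintegrable mu (fun x => f x + g x).
Proof.
move=> [f1 f2] [g1 g2]; split.
  apply: eq_integrable (rintegrableD f1 g1) => // x _.
  by rewrite /=; case: (f x) (g x) => ? ? [].
apply: eq_integrable (rintegrableD f2 g2) => // x _.
by rewrite /=; case: (f x) (g x) => ? ? [].
Qed.

Lemma cintegralD mu f g : cintegrable mu f -> cintegrable mu g ->
  complex_integral mu (fun x => f x + g x) =
  complex_integral mu f + complex_integral mu g.
Proof.
move=> [f1 f2] [g1 g2]; rewrite /complex_integral.
rewrite -[RHS]/((_ + _) +i* (_ + _)) -!RintegralD //; congr (_ +i* _);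
  by apply: eq_Rintegral => x _; case: (f x) (g x) => ? ? [].
Qed.

Lemma cintegrableZ mu c f : cintegrable mu f -> cintegrable mu (fun x => c * f x).
Proof.
move=> [f1 f2]; split.
  apply: eq_integrable (rintegrableD (rintegrableZ (complex.Re c) f1)
    (rintegrableN (rintegrableZ (complex.Im c) f2))) => // x _.
  by rewrite /=; case: (f x) c => ? ? [].
apply: eq_integrable (rintegrableD (rintegrableZ (complex.Re c) f2)
  (rintegrableZ (complex.Im c) f1)) => // x _.
by rewrite /=; case: (f x) c => ? ? [].
Qed.

Lemma cintegralZ mu c f : cintegrable mu f ->
  complex_integral mu (fun x => c * f x) = c * complex_integral mu f.
Proof.
move=> [f1 f2]; rewrite /complex_integral; case: c => a b.
rewrite -[RHS]/((_ - _) +i* (_ + _)) -!RintegralZl // -RintegralB -?RintegralD //;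
  try exact: rintegrableZ.
by congr (_ +i* _); apply: eq_Rintegral => x _; case: (f x).
Qed.

Lemma cintegrableB mu f g : cintegrable mu f -> cintegrable mu g ->
  cintegrable mu (fun x => f x - g x).
Proof.
move=> mf mg; have := cintegrableD mf (cintegrableZ (-1) mg).
by under eq_fun do rewrite mulN1r.
Qed.

Lemma cintegralB mu f g : cintegrable mu f -> cintegrable mu g ->
  complex_integral mu (fun x => f x - g x) =
  complex_integral mu f - complex_integral mu g.
Proof.
move=> mf mg; rewrite -[- _]mulN1r -cintegralZ // -cintegralD //.
  by apply: eq_cintegral => x; rewrite mulN1r.
exact: cintegrableZ.
Qed.

Lemma cintegral_sum mu n (F : nat -> R -> R[i]) :
  (forall k, cintegrable mu (F k)) ->
  cintegrable mu (fun x => \sum_(k < n) F k x) /\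
  complex_integral mu (fun x => \sum_(k < n) F k x) =
  \sum_(k < n) complex_integral mu (F k).
Proof.
move=> iF; elim: n => [|n [IH1 IH2]].
  rewrite big_ord0; split; last first.
    by rewrite -[RHS](cintegral_cst mu); apply: eq_cintegral => x; rewrite big_ord0.
  by under eq_fun do rewrite big_ord0; exact: cintegrable_cst.
under eq_fun do rewrite big_ord_recr /=.
by split; [exact: cintegrableD | rewrite cintegralD // IH2 big_ord_recr].
Qed.

(** Real and imaginary parts are estimated separately, hence the factor 2. *)
Lemma normc_cintegral_le mu f v : cintegrable mu f -> rintegrable mu v ->
  (forall x, normc (f x) <= v x) ->
  normc (complex_integral mu f) <= 2 * \int[mu]_x v x.
Proof.
move=> [f1 f2] iv fv; rewrite mulr_natl mulr2n.
apply: le_trans (normc_le_ReIm _) _; apply: lerD; apply: Rintegral_norm_le => // x;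
  by rewrite (le_trans _ (fv x)) // ?Re_le_normc ?Im_le_normc.
Qed.

Lemma normc_cintegral_bounded mu f M : cintegrable mu f ->
  (forall x, normc (f x) <= M) -> normc (complex_integral mu f) <= 2 * M.
Proof.
move=> fi fM; rewrite -(Rintegral_prob_cst mu M).
by apply: normc_cintegral_le => //; exact: rintegrable_cst.
Qed.

End ComplexIntegral.

(** * Resolvent bounds and the Cauchy transform *)

Section Resolvent.
Context {R : realType}.
Implicit Types (mu : borel_prob R) (z w : R[i]) (x : R).

Lemma ReB_real z x : complex.Re (z - x%:C) = complex.Re z - x.
Proof. by case: z => a b /=. Qed.

Lemma ImB_real z x : complex.Im (z - x%:C) = complex.Im z.
Proof. by case: z => a b /=; rewrite oppr0 addr0. Qed.

Lemma resolvent_neq0 z x : 0 < complex.Im z -> z - x%:C != 0.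
Proof.
move=> z0; apply: contraTneq z0 => zx.
by rewrite -(ImB_real z x) zx ltxx.
Qed.

Lemma resolvent_Re z x : complex.Re (z - x%:C)^-1 =
  (complex.Re z - x) / ((complex.Re z - x) ^+ 2 + complex.Im z ^+ 2).
Proof. by case: z => a b /=; rewrite oppr0 addr0. Qed.

Lemma resolvent_Im z x : complex.Im (z - x%:C)^-1 =
  - complex.Im z / ((complex.Re z - x) ^+ 2 + complex.Im z ^+ 2).
Proof. by case: z => a b /=; rewrite oppr0 addr0 mulNr. Qed.

Lemma resolvent_den_gt0 z x : 0 < complex.Im z ->
  0 < (complex.Re z - x) ^+ 2 + complex.Im z ^+ 2.
Proof. by move=> z0; rewrite ltr_wpDl ?sqr_ge0 // exprn_gt0. Qed.

Lemma cmeasurable_resolvent z : 0 < complex.Im z ->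
  cmeasurable (fun x => (z - x%:C)^-1).
Proof.
move=> z0.
have cden : continuous (fun x : R => ((complex.Re z - x) ^+ 2 + complex.Im z ^+ 2)^-1).
  move=> x; apply: cvgV; first by rewrite gt_eqF ?resolvent_den_gt0.
  by apply: cvgD; [apply: cvgM; (apply: cvgB; [exact: cvg_cst|exact: cvg_id]) | exact: cvg_cst].
split.
  apply: eq_measurable_fun (_ : measurable_fun _ (fun x =>
    (complex.Re z - x) * ((complex.Re z - x) ^+ 2 + complex.Im z ^+ 2)^-1)).
    by move=> x _; rewrite resolvent_Re.
  apply: continuous_measurable_fun => x; apply: cvgM; last exact: cden.
  by apply: cvgB; [exact: cvg_cst|exact: cvg_id].
apply: eq_measurable_fun (_ : measurable_fun _ (fun x =>
    (- complex.Im z) * ((complex.Re z - x) ^+ 2 + complex.Im z ^+ 2)^-1)).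
  by move=> x _; rewrite resolvent_Im.
apply: continuous_measurable_fun => x; apply: cvgM; last exact: cden.
exact: cvg_cst.
Qed.

Lemma normc_sub_real_ge z x : complex.Im z <= normc (z - x%:C).
Proof. by rewrite -(ImB_real z x) (le_trans (ler_norm _)) // Im_le_normc. Qed.

Lemma normc_resolvent_le z x : 0 < complex.Im z ->
  normc (z - x%:C)^-1 <= (complex.Im z)^-1.
Proof.
move=> z0; rewrite normcV lef_pV2 ?posrE ?normc_sub_real_ge //.
by rewrite (lt_le_trans z0) ?normc_sub_real_ge.
Qed.

Lemma cintegrable_resolvent mu z : 0 < complex.Im z ->
  cintegrable mu (fun x => (z - x%:C)^-1).
Proof.
move=> z0; apply: cintegrable_bounded (cmeasurable_resolvent z0) _ => x.
exact: normc_resolvent_le.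
Qed.

Lemma cintegrable_resolventM mu z w : 0 < complex.Im z -> 0 < complex.Im w ->
  cintegrable mu (fun x => (z - x%:C)^-1 * (w - x%:C)^-1).
Proof.
move=> z0 w0; apply: (@cintegrable_bounded _ _ _ ((complex.Im z)^-1 * (complex.Im w)^-1)).
  by apply: cmeasurableM; exact: cmeasurable_resolvent.
by move=> x; rewrite normcM ler_pM ?normc_ge0 ?normc_resolvent_le.
Qed.

(** The resolvent identity, integrated against [mu]. *)
Lemma cauchy_diff mu z w : 0 < complex.Im z -> 0 < complex.Im w ->
  cauchy_transform mu z - cauchy_transform mu w =
  (w - z) * complex_integral mu (fun x => (z - x%:C)^-1 * (w - x%:C)^-1).
Proof.
move=> z0 w0; rewrite /cauchy_transform.
rewrite -cintegralB; try exact: cintegrable_resolvent.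
rewrite -cintegralZ; last exact: cintegrable_resolventM.
apply: eq_cintegral => x; have := resolvent_neq0 x z0; have := resolvent_neq0 x w0.
by move=> *; field; apply/andP.
Qed.

Lemma cauchy_lipschitz mu z w : 0 < complex.Im z -> 0 < complex.Im w ->
  normc (cauchy_transform mu z - cauchy_transform mu w) <=
  2 * normc (z - w) / (complex.Im z * complex.Im w).
Proof.
move=> z0 w0; rewrite cauchy_diff // normcM [normc (w - z)]normcC.
rewrite [2 * _]mulrC -mulrA ler_wpM2l ?normc_ge0 //.
apply: normc_cintegral_bounded; first exact: cintegrable_resolventM.
by move=> x; rewrite normcM invfM ler_pM ?normc_ge0 ?normc_resolvent_le.
Qed.

Lemma rintegrable_resolvent_sqr mu z : 0 < complex.Im z ->
  rintegrable mu (fun x => normc (z - x%:C)^-1 ^+ 2).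
Proof.
move=> z0; have [mr mi] := cmeasurable_resolvent z0.
apply: (@bounded_rintegrable _ _ _ ((complex.Im z)^-1 ^+ 2)).
  apply: eq_measurable_fun (measurable_funD (measurable_funM mr mr) (measurable_funM mi mi)) => x _.
  by rewrite normc_sqr /= -!expr2.
move=> x; rewrite ger0_norm ?sqr_ge0 // lerXn2r ?nnegrE ?normc_ge0 ?invr_ge0 ?(ltW z0) //.
exact: normc_resolvent_le.
Qed.

Lemma Im_cauchy mu z : 0 < complex.Im z ->
  complex.Im (cauchy_transform mu z) =
  - complex.Im z * \int[mu]_x (normc (z - x%:C)^-1 ^+ 2).
Proof.
move=> z0; rewrite /cauchy_transform /= -RintegralZl //.
  apply: eq_Rintegral => x _; rewrite resolvent_Im normcV exprVn normc_sqr.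
  by rewrite ReB_real ImB_real.
exact: rintegrable_resolvent_sqr.
Qed.

(** Expand the integral of (u - a)^2, which is nonnegative, where a is the mean of u. *)
Lemma sqr_Rintegral_le mu (u : R -> R) : rintegrable mu u ->
  rintegrable mu (fun x => u x ^+ 2) ->
  (\int[mu]_x u x) ^+ 2 <= \int[mu]_x (u x ^+ 2).
Proof.
move=> iu iu2; set a := \int[mu]_x u x.
have : 0 <= \int[mu]_x (u x ^+ 2 + ((- 2 * a) * u x + a ^+ 2)).
  by apply: Rintegral_ge0 => x _; have := sqr_ge0 (u x - a); congr (_ <= _); ring.
have i1 := rintegrableZ (- 2 * a) iu; have i2 := rintegrable_cst mu (a ^+ 2).
rewrite RintegralD //; last exact: rintegrableD.
rewrite RintegralD // RintegralZl // Rintegral_prob_cst -/a; lra.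
Qed.

Lemma normc_cauchy_sqr_le mu z : 0 < complex.Im z ->
  normc (cauchy_transform mu z) ^+ 2 <= \int[mu]_x (normc (z - x%:C)^-1 ^+ 2).
Proof.
move=> z0; have [mr mi] := cmeasurable_resolvent z0.
have [ir ii] := cintegrable_resolvent mu z0.
have bnd (p : R[i] -> R) : (forall w, `|p w| <= normc w) ->
    measurable_fun [set: measurableTypeR R] (fun x => p (z - x%:C)^-1) ->
    rintegrable mu (fun x => p (z - x%:C)^-1 ^+ 2).
  move=> pn mp; apply: (@bounded_rintegrable _ _ _ ((complex.Im z)^-1 ^+ 2)).
    by apply: eq_measurable_fun (measurable_funM mp mp) => x _.
  move=> x; rewrite ger0_norm ?sqr_ge0 // -real_normK ?num_real //.
  rewrite lerXn2r ?nnegrE ?invr_ge0 ?(ltW z0) //.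
  by rewrite (le_trans (pn _)) ?normc_resolvent_le.
have ir2 := bnd _ (@Re_le_normc R) mr; have ii2 := bnd _ (@Im_le_normc R) mi.
rewrite normc_sqr /cauchy_transform /=.
apply: (le_trans (lerD (sqr_Rintegral_le ir ir2) (sqr_Rintegral_le ii ii2))).
rewrite -RintegralD //; apply: le_Rintegral => //.
- exact: rintegrableD.
- exact: rintegrable_resolvent_sqr.
- by move=> x _; rewrite normc_sqr.
Qed.

End Resolvent.

(** * The reciprocal Cauchy transform on the upper half-plane *)

Section Reciprocal.
Context {R : realType}.
Implicit Types (mu : borel_prob R) (z : R[i]).

(** Up to the factor - Im z, the imaginary part of G is the integral of the everywhere positive
    function |z - x|^(-2). Were it zero, the function would vanish almost everywhere and the whole
    line would be a null set. *)
Lemma cauchy_neq0 mu z : 0 < complex.Im z -> cauchy_transform mu z != 0.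
Proof.
move=> z0; apply/eqP => G0.
have I0 : \int[mu]_x (normc (z - x%:C)^-1 ^+ 2) = 0.
  have := Im_cauchy mu z0; rewrite G0 /= => /esym/eqP.
  by rewrite mulf_eq0 oppr_eq0 gt_eqF //= => /eqP.
have ir := rintegrable_resolvent_sqr mu z0.
have : (\int[mu]_x `|(normc (z - x%:C)^-1 ^+ 2)%:E| = 0)%E.
  rewrite -[RHS]/(0%:E) -I0 /Rintegral fineK; last exact: integrable_fin_num.
  by apply: eq_integral => x _; rewrite /= ger0_norm // sqr_ge0.
move/ae_eq_integral_abs => -[] //; first exact: (measurable_int mu).
move=> N [mN N0 sub].
suff NT : N = setT by have := probability_setT mu; rewrite -NT N0 => /eqP; rewrite eqe eq_sym oner_eq0.
apply/seteqP; split => // x _; apply: sub => /= /(_ I)[] /eqP.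
by rewrite sqrf_eq0 normc_eq0 invr_eq0 (negbTE (resolvent_neq0 x z0)).
Qed.

(** Im F = - Im G / |G|^2 is Im z times the ratio of the mean of |z - x|^(-2) to |G|^2, and the
    ratio is at least 1 by [normc_cauchy_sqr_le]. This keeps subordination points at least as high
    as z. *)
Lemma Im_recip_cauchy_ge mu z : 0 < complex.Im z ->
  complex.Im z <= complex.Im (recip_cauchy mu z).
Proof.
move=> z0; rewrite /recip_cauchy; have G0 := cauchy_neq0 mu z0.
have ImV (w : R[i]) : complex.Im w^-1 = - complex.Im w / normc w ^+ 2.
  by rewrite normc_sqr; case: w => a b /=; rewrite mulNr.
rewrite ImV Im_cauchy // [- complex.Im z * _]mulNr opprK -mulrA ler_pMr // ler_pdivlMr ?mul1r.
  exact: normc_cauchy_sqr_le.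
by rewrite exprn_gt0 // normc_gt0.
Qed.

Lemma recip_cauchyV mu z : (recip_cauchy mu z)^-1 = cauchy_transform mu z.
Proof. by rewrite /recip_cauchy invrK. Qed.

End Reciprocal.

(** * Kolmogorov distance and measures of intervals *)

Section Kolmogorov.
Context {R : realType}.
Implicit Types (mu nu : borel_prob R) (delta : R) (z : R[i]).

Definition cdf_close mu nu delta :=
  forall x : R, `|fine (mu `]-oo, x[%classic) - fine (nu `]-oo, x[%classic)| <= delta.

Lemma kolmogorov_close mu nu delta :
  (kolmogorov mu nu <= delta%:E)%E -> cdf_close mu nu delta.
Proof.
move=> kd x; rewrite -lee_fin; apply: le_trans kd.
apply: ereal_sup_ubound; exists x => //.
have fm (m : borel_prob R) : m `]-oo, x[%classic \is a fin_num.
  exact: fin_num_measure.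
by rewrite -[in LHS](fineK (fm mu)) -[in LHS](fineK (fm nu)).
Qed.

Lemma cdf_close_ge0 mu nu delta : cdf_close mu nu delta -> 0 <= delta.
Proof. by move/(_ 0); apply: le_trans. Qed.

(** A closed ray is the decreasing intersection of the open rays ending at x + 1/(n+1). *)
Lemma cdf_close_right mu nu delta : cdf_close mu nu delta ->
  forall x : R, `|fine (mu `]-oo, x]%classic) - fine (nu `]-oo, x]%classic)| <= delta.
Proof.
move=> d x.
have cv (m : borel_prob R) :
    (fun n : nat => fine (m `]-oo, x + n.+1%:R^-1[%classic)) @ \oo --> fine (m `]-oo, x]%classic).
  rewrite (itvNycEbigcap true); apply: fine_cvg; rewrite fineK.
  apply: nonincreasing_cvg_mu => //.
  - by rewrite (le_lt_trans (probability_le1 m _)) ?ltry.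
  - exact: bigcap_measurable.
  - move=> n k nk; apply/subsetPset => y /=; rewrite !in_itv /= => /lt_le_trans; apply.
    by rewrite lerD2l lef_pV2 ?posrE // ler_nat.
  by rewrite fin_num_measure //; exact: bigcap_measurable.
have cvn : (fun n : nat => `|fine (mu `]-oo, x + n.+1%:R^-1[%classic) -
    fine (nu `]-oo, x + n.+1%:R^-1[%classic)|) @ \oo -->
    `|fine (mu `]-oo, x]%classic) - fine (nu `]-oo, x]%classic)|.
  by apply: cvg_norm; apply: cvgB.
rewrite -(cvg_lim _ cvn) //; apply: limr_le; first by apply/cvg_ex; eexists; exact: cvn.
by apply: nearW => n; exact: d.
Qed.

(** An interval is the difference of two rays, each measured up to [delta]. *)
Lemma itv_close mu nu delta : cdf_close mu nu delta ->
  forall i : interval R, `|fine (mu [set` i]) - fine (nu [set` i])| <= 2 * delta.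
Proof.
move=> d [a b]; have d0 := cdf_close_ge0 d.
have ray c : `|fine (mu [set` Interval -oo%O c]) - fine (nu [set` Interval -oo%O c])| <= delta.
  case: c => [[] x|[]]; [exact: d|exact: cdf_close_right|by rewrite set_itvE !measure0 subrr normr0|].
  by rewrite set_itvNyy !probability_setT subrr normr0.
case: (leP a b) => [ab|/ltW ba]; last first.
  rewrite set_itv_ge -?leNgt ?bnd_simp; last by move: a b ba => [[] x|[]] [[] y|[]].
  by rewrite !measure0 subrr normr0 mulr_ge0.
have split_ray (m : borel_prob R) : fine (m [set` Interval a b]) =
    fine (m [set` Interval -oo%O b]) - fine (m [set` Interval -oo%O a]).
  rewrite (@itv_bndbnd_setU _ _ -oo%O a b) // measureU ?fineD ?fin_num_measure //; first by ring.
  apply/seteqP; split => // x []; rewrite /= !in_itv /=.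
  move: a {ab ray} => [[] y|[]] //= xy /andP[yx _].
    by have := lt_le_trans xy yx; rewrite ltxx.
  by have := le_lt_trans xy yx; rewrite ltxx.
rewrite !split_ray; have := ray a; have := ray b.
by rewrite !ler_norml => /andP[? ?] /andP[? ?]; apply/andP; split; lra.
Qed.

End Kolmogorov.

(** * Cauchy transforms of Kolmogorov-close measures *)

Section LayerCake.
Context {R : realType}.
Implicit Types (mu nu : borel_prob R) (delta B : R) (f : R -> R).

(** S counts the j < n below t: it is the ceiling of t capped at n. *)
Lemma sum_lt_index (t : R) n : 0 <= t ->
  let S := \sum_(j < n) ((j%:R < t)%R : nat)%:R in
  [/\ S <= t + 1, S <= n%:R & t <= S \/ n%:R <= S].
Proof.
move=> t0; elim: n => [|n [IH1 IH2 IH3]] /=.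
  by rewrite big_ord0; split; [rewrite addr_ge0| |right].
rewrite big_ord_recr /= -natr1; have n0 : 0 <= n%:R :> R by [].
move: (\sum_(i < n) _) (n%:R : R) n0 IH1 IH2 IH3 => S N N0 IH1 IH2 IH3.
case: (ltP N t) => nt /=; split; lra.
Qed.

(* [f] is within [B / n] of an average of [n] indicators of its superlevel sets. *)
Lemma interval_superlevel_close mu nu delta B f : cdf_close mu nu delta -> 0 < B ->
  measurable_fun [set: measurableTypeR R] f ->
  (forall x, 0 <= f x <= B) -> (forall s, 0 <= s -> is_interval [set x | s < f x]) ->
  `|\int[mu]_x f x - \int[nu]_x f x| <= 2 * B * delta.
Proof.
move=> d B0 mf fB fI.
have If (m : borel_prob R) : rintegrable m f.
  by apply: (@bounded_rintegrable _ _ _ B) => // x; have /andP[? ?] := fB x; rewrite ger0_norm.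
suff H n : `|\int[mu]_x f x - \int[nu]_x f x| <= 2 * B * delta + 2 * B * n.+1%:R^-1.
  apply/ler_addgt0Pr => e e0.
  have [n nP] := ltr_add_invr (divr_gt0 e0 (mulr_gt0 (ltr0Sn R 1) B0)).
  apply: le_trans (H n) _; rewrite lerD2l.
  move: nP; rewrite add0r => /ltW; rewrite ler_pdivlMr ?mulr_gt0 // => nP.
  by rewrite mulrC.
pose A j := [set x | B * j%:R / n.+1%:R < f x].
have mA j : measurable (A j : set (measurableTypeR R)).
  by apply: is_interval_measurable; apply: fI; rewrite !mulr_ge0 // ?invr_ge0 // ltW.
pose g x := \sum_(j < n.+1) B / n.+1%:R * \1_(A j) x.
have iA (m : borel_prob R) j : rintegrable m (\1_(A j)) /\ \int[m]_x \1_(A j) x = fine (m (A j)).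
  split; last by rewrite /Rintegral integral_indic // setIT.
  apply: (@bounded_rintegrable _ _ _ 1); first exact: measurable_indic.
  by move=> x; rewrite indicE; case: (_ \in _); rewrite ?normr1 ?normr0.
have ig (m : borel_prob R) : rintegrable m g /\
    \int[m]_x g x = \sum_(j < n.+1) B / n.+1%:R * fine (m (A j)).
  rewrite /g; set c := B / _; elim: n.+1 => [|k [IH1 IH2]].
    rewrite big_ord0 (_ : (fun x => _) = fun=> 0) ?Rintegral_prob_cst; last first.
      by apply/funext => x; rewrite big_ord0.
    by split => //; exact: rintegrable_cst.
  have [i1 i2] := iA m k.
  under eq_fun do rewrite big_ord_recr /=.
  split; first by apply: rintegrableD => //; exact: rintegrableZ.
  rewrite big_ord_recr /= -IH2 -i2 -RintegralZl // -RintegralD //; last exact: rintegrableZ.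
have n0 : 0 < n.+1%:R :> R by rewrite ltr0n.
have fg x : f x <= g x <= f x + B / n.+1%:R.
  have /andP[f0 f1] := fB x.
  have Bn : 0 < B / n.+1%:R by rewrite divr_gt0.
  have t0 : 0 <= f x / (B / n.+1%:R) by rewrite divr_ge0 // ltW.
  (* x lies in [A j] exactly when j is below f(x) n'/B with n' = n + 1, so g(x) is f(x) rounded up
     to a multiple of B/n'. *)
  have -> : g x = B / n.+1%:R * \sum_(j < n.+1) ((j%:R < f x / (B / n.+1%:R))%R : nat)%:R.
    rewrite mulr_sumr; apply: eq_bigr => j _; rewrite indicE; congr (_ * (_ : bool)%:R).
    by rewrite mem_setE /= ltr_pdivlMr // mulrCA mulrA.
  have [H3 _ H1'] := @sum_lt_index _ n.+1 t0.
  have ft : f x / (B / n.+1%:R) <= n.+1%:R.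
    by rewrite ler_pdivrMr // mulrC divfK ?gt_eqF.
  move: H3 H1'; set S := \sum_(j < _) _ => H3 H1'.
  have H1 : f x / (B / n.+1%:R) <= S by case: H1' => // /(le_trans ft).
  apply/andP; split; first by move: H1; rewrite ler_pdivrMr // mulrC.
  by rewrite -ler_pdivlMl // mulrDr mulVf ?gt_eqF // mulrC.
have fgi (m : borel_prob R) : \int[m]_x f x <= \int[m]_x g x <= \int[m]_x f x + B / n.+1%:R.
  have [i1 _] := ig m; apply/andP; split.
    by apply: le_Rintegral => //; [exact: If | move=> x _; have /andP[] := fg x].
  rewrite -[B / _](Rintegral_prob_cst m) -RintegralD //; [|exact: If|exact: rintegrable_cst].
  apply: le_Rintegral => //; first by apply: rintegrableD (If m) _; exact: rintegrable_cst.
  by move=> x _; have /andP[] := fg x.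
have gd : `|\int[mu]_x g x - \int[nu]_x g x| <= 2 * B * delta.
  rewrite (ig mu).2 (ig nu).2 -sumrB; apply: le_trans (ler_norm_sum _ _ _) _.
  apply: (@le_trans _ _ (\sum_(j < n.+1) B / n.+1%:R * (2 * delta))).
    apply: ler_sum => j _; rewrite -mulrBr normrM ger0_norm ?divr_ge0 ?(ltW B0) //.
    rewrite ler_wpM2l ?divr_ge0 ?(ltW B0) //.
    have /is_intervalP -> : is_interval (A j).
      by apply: fI; rewrite !mulr_ge0 // ?invr_ge0 // ltW.
    exact: itv_close.
  rewrite sumr_const card_ord -mulr_natr le_eqVlt; apply/orP; left; apply/eqP.
  by field; rewrite gt_eqF.
have fin (F F' G G' e k : R) : `|G - G'| <= e -> F <= G <= F + k ->
    F' <= G' <= F' + k -> `|F - F'| <= e + k.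
  rewrite !ler_norml => /andP[? ?] /andP[? ?] /andP[? ?].
  by apply/andP; split; lra.
apply: le_trans (fin _ _ _ _ _ _ gd (fgi mu) (fgi nu)) _.
by rewrite lerD2l ler_wpM2r ?invr_ge0 // ler_peMl ?ler1n // ltW.
Qed.

(* Makes the superlevel sets of Re and Im of the resolvent intervals. *)
Lemma quadratic_neg_convex (s c k v1 v2 v3 : R) : 0 <= s -> v3 <= v2 -> v2 <= v1 ->
  s * v1 ^+ 2 + c * v1 + k < 0 -> s * v3 ^+ 2 + c * v3 + k < 0 ->
  s * v2 ^+ 2 + c * v2 + k < 0.
Proof.
move=> s0 v32 v21 h1 h3; case: (leP 0 (s * (v2 + v1) + c)) => H.
  have : 0 <= (v1 - v2) * (s * (v2 + v1) + c) by rewrite mulr_ge0 ?subr_ge0.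
  lra.
have H' : s * (v2 + v3) + c <= 0 by nra.
have : 0 <= (v2 - v3) * - (s * (v2 + v3) + c) by rewrite mulr_ge0 ?subr_ge0 ?oppr_ge0.
lra.
Qed.

(** The resolvent is cut into the positive and negative parts of its real part and minus its
    imaginary part. Each takes values in [0, 1/Im z] and has intervals as superlevel sets, so each
    contributes 2 delta / Im z. *)
Lemma cauchy_close mu nu delta (z : R[i]) : cdf_close mu nu delta -> 0 < complex.Im z ->
  normc (cauchy_transform mu z - cauchy_transform nu z) <= 6 * delta / complex.Im z.
Proof.
move=> d z0; have [mr mi] := cmeasurable_resolvent z0.
have y0 : 0 < (complex.Im z)^-1 by rewrite invr_gt0.
have rn x : normc (z - x%:C)^-1 <= (complex.Im z)^-1 by exact: normc_resolvent_le.
have D0 x := resolvent_den_gt0 x z0.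
have mrN : measurable_fun [set: measurableTypeR R] (fun x => - complex.Re (z - x%:C)^-1).
  exact: measurableT_comp.
have miN : measurable_fun [set: measurableTypeR R] (fun x => - complex.Im (z - x%:C)^-1).
  exact: measurableT_comp.
have m0 : measurable_fun [set: measurableTypeR R] (fun=> 0 : R) by exact: measurable_cst.
pose p x := Num.max 0 (complex.Re (z - x%:C)^-1).
pose q x := Num.max 0 (- complex.Re (z - x%:C)^-1).
pose r x := - complex.Im (z - x%:C)^-1.
have max_bnd (u : R) x : `|u| <= (complex.Im z)^-1 -> 0 <= Num.max 0 u <= (complex.Im z)^-1.
  by move=> uB; rewrite le_max lexx /= ge_max (ltW y0) (le_trans (ler_norm u)).
have mp : measurable_fun [set: measurableTypeR R] p by apply: measurable_maxr.
have mq : measurable_fun [set: measurableTypeR R] q by apply: measurable_maxr.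
have pB x : 0 <= p x <= (complex.Im z)^-1.
  by apply: max_bnd => //; rewrite (le_trans (Re_le_normc _)).
have qB x : 0 <= q x <= (complex.Im z)^-1.
  by apply: max_bnd => //; rewrite normrN (le_trans (Re_le_normc _)).
have rB x : 0 <= r x <= (complex.Im z)^-1.
  apply/andP; split; last by rewrite (le_trans (ler_norm _)) // normrN (le_trans (Im_le_normc _)).
  by rewrite /r resolvent_Im mulNr opprK divr_ge0 // ltW.
have pd : `|\int[mu]_x p x - \int[nu]_x p x| <= 2 * (complex.Im z)^-1 * delta.
  apply: interval_superlevel_close => // s s0 x1 x3; rewrite /= !lt_max !ltNge s0 /= -!ltNge.
  rewrite !resolvent_Re !ltr_pdivlMr // => H1 H3 x2 /andP[x12 x23].
  rewrite lt_max ltNge s0 /= resolvent_Re ltr_pdivlMr //.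
  (* With v = Re z - x and the denominator cleared, lying above level s reads s v^2 - v + s (Im z)^2
     < 0; the two other parts differ only in their coefficients. *)
  have := @quadratic_neg_convex s (-1) (s * complex.Im z ^+ 2) (complex.Re z - x1)
    (complex.Re z - x2) (complex.Re z - x3) s0.
  rewrite !lerD2l !lerN2 => /(_ x23 x12).
  by move=> H; have := H _ _; lra.
have qd : `|\int[mu]_x q x - \int[nu]_x q x| <= 2 * (complex.Im z)^-1 * delta.
  apply: interval_superlevel_close => // s s0 x1 x3; rewrite /= !lt_max !ltNge s0 /= -!ltNge.
  rewrite !resolvent_Re -!mulNr !ltr_pdivlMr // => H1 H3 x2 /andP[x12 x23].
  rewrite lt_max ltNge s0 /= resolvent_Re -mulNr ltr_pdivlMr //.
  have := @quadratic_neg_convex s 1 (s * complex.Im z ^+ 2) (complex.Re z - x1)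
    (complex.Re z - x2) (complex.Re z - x3) s0.
  rewrite !lerD2l !lerN2 => /(_ x23 x12).
  by move=> H; have := H _ _; lra.
have rd : `|\int[mu]_x r x - \int[nu]_x r x| <= 2 * (complex.Im z)^-1 * delta.
  apply: interval_superlevel_close => // s s0 x1 x3; rewrite /= /r.
  rewrite !resolvent_Im -!mulNr opprK !ltr_pdivlMr // => H1 H3 x2 /andP[x12 x23].
  rewrite resolvent_Im -mulNr opprK ltr_pdivlMr //.
  have := @quadratic_neg_convex s 0 (s * complex.Im z ^+ 2 - complex.Im z)
    (complex.Re z - x1) (complex.Re z - x2) (complex.Re z - x3) s0.
  rewrite !lerD2l !lerN2 => /(_ x23 x12).
  by move=> H; have := H _ _; lra.
have bi (m : borel_prob R) (u : R -> R) : measurable_fun [set: measurableTypeR R] u ->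
    (forall x, 0 <= u x <= (complex.Im z)^-1) -> rintegrable m u.
  move=> mu_ uB; apply: (@bounded_rintegrable _ _ _ (complex.Im z)^-1) => // x.
  by have /andP[? ?] := uB x; rewrite ger0_norm.
have Re_pq (m : borel_prob R) : complex.Re (cauchy_transform m z) = \int[m]_x p x - \int[m]_x q x.
  rewrite -RintegralB; try exact: bi; last by [].
  apply: eq_Rintegral => x _; rewrite /p /q /=.
  case: (leP 0 (complex.Re (z - x%:C)^-1)) => H.
    by rewrite max_l ?subr0 // oppr_le0.
  by rewrite max_r ?oppr_ge0 ?(ltW H) // sub0r opprK.
have Im_r (m : borel_prob R) : complex.Im (cauchy_transform m z) = - \int[m]_x r x.
  rewrite -mulN1r -RintegralZl; try exact: bi; last by [].
  by apply: eq_Rintegral => x _; rewrite /r mulN1r opprK.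
apply: le_trans (normc_le_ReIm _) _.
have -> (a b : R[i]) : complex.Re (a - b) = complex.Re a - complex.Re b by case: a b => ? ? [].
have -> (a b : R[i]) : complex.Im (a - b) = complex.Im a - complex.Im b by case: a b => ? ? [].
rewrite !Re_pq !Im_r.
have tri (P P' Q Q' S S' e : R) : `|P - P'| <= e -> `|Q - Q'| <= e -> `|S - S'| <= e ->
    `|P - Q - (P' - Q')| + `|- S - - S'| <= 3 * e.
  move=> HP HQ HS; rewrite -opprD normrN.
  have -> : P - Q - (P' - Q') = (P - P') - (Q - Q') by ring.
  by apply: le_trans (lerD (ler_normB _ _) (lexx _)) _; lra.
apply: le_trans (tri _ _ _ _ _ _ _ pd qd rd) _.
by rewrite le_eqVlt; apply/orP; left; apply/eqP; ring.
Qed.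

End LayerCake.

Section ImaginaryPart.
Context {R : realType}.
Implicit Types (z w : R[i]) (a : R).

Lemma Im_add z w : complex.Im (z + w) = complex.Im z + complex.Im w.
Proof. by case: z w => ? ? []. Qed.

Lemma Im_sub z w : complex.Im (z - w) = complex.Im z - complex.Im w.
Proof. by case: z w => ? ? []. Qed.

Lemma Im_scale a z : complex.Im (a%:C * z) = a * complex.Im z.
Proof. by case: z => ? ? /=; rewrite mul0r addr0. Qed.

Lemma Im_natmul n z : complex.Im (n%:R * z) = n%:R * complex.Im z.
Proof. by rewrite -Im_scale rmorph_nat. Qed.

Lemma Im_divn n z : complex.Im (z / n%:R) = complex.Im z / n%:R.
Proof. by rewrite mulrC -[n%:R in LHS](rmorph_nat (real_complex R)) -fmorphV Im_scale mulrC. Qed.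

Lemma normc_nat n : normc (n%:R : R[i]) = n%:R.
Proof. by rewrite -(rmorph_nat (real_complex R)) normc_real ger0_norm. Qed.

Lemma Im_gt0_near z h : 0 < complex.Im z -> normc h <= complex.Im z / 2 ->
  complex.Im z / 2 <= complex.Im (z + h).
Proof.
move=> z0 hz; have := Im_le_normc h; rewrite ler_norml Im_add => /andP[? _]; lra.
Qed.

End ImaginaryPart.

(** * Subordination of free powers *)

Section IdentityTheorem.
Context {R : realType}.
Implicit Types (mu lam : borel_prob R) (z h : R[i]) (f : R[i] -> R[i]).

(** Continuation along the segment from z0 to z1: [papprox_identity] makes [f] vanish on a disc
    around any point where its zeros accumulate, so the supremum S of the parameters up to which [f]
    vanishes cannot be below 1. *)
Lemma upper_identity f z0 :
  (forall z, 0 < complex.Im z -> exists2 r, 0 < r & papprox (fun h => f (z + h)) r) ->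
  0 < complex.Im z0 ->
  (forall e, 0 < e -> exists h, [/\ h != 0, normc h <= e & f (z0 + h) = 0]) ->
  forall z, 0 < complex.Im z -> f z = 0.
Proof.
move=> fapp z00 facc z1 z10.
have ball z : 0 < complex.Im z ->
    (forall e, 0 < e -> exists h, [/\ h != 0, normc h <= e & f (z + h) = 0]) ->
    exists2 r, 0 < r & forall h, normc h <= r -> f (z + h) = 0.
  move=> z_gt0 acc; have [r r0 fr] := fapp _ z_gt0; exists (r / 4); first by rewrite divr_gt0.
  exact: (papprox_identity r0 fr acc).
have fz0 : f z0 = 0.
  by have [r r0 /(_ 0)] := ball _ z00 facc; rewrite normc0 addr0; apply; exact: ltW.
have [<- //|neq01] := eqVneq z0 z1.
have D0 : 0 < normc (z1 - z0) by rewrite normc_gt0 subr_eq0 eq_sym.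
set D := normc _ in D0.
pose g (s : R) := z0 + s%:C * (z1 - z0).
have g1 : g 1 = z1 by rewrite /g mul1r addrC subrK.
have gB s t : g s - g t = (s - t)%:C * (z1 - z0).
  by rewrite /g rmorphB /=; ring.
have gI s : 0 <= s <= 1 -> 0 < complex.Im (g s).
  move=> /andP[s0 s1]; rewrite /g Im_add Im_scale Im_sub.
  have [->|sn0] := eqVneq s 0; first by rewrite mul0r addr0.
  have s_gt0 : 0 < s by rewrite lt_neqAle eq_sym sn0.
  have : 0 < s * complex.Im z1 by rewrite mulr_gt0.
  have : 0 <= (1 - s) * complex.Im z0 by rewrite mulr_ge0 ?subr_ge0 // ltW.
  lra.
pose T := [set s : R | 0 <= s <= 1 /\ forall t, 0 <= t <= s -> f (g t) = 0].
have T0 : T 0.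
  split; first by rewrite lexx ler01.
  by move=> t t0; rewrite -(le_anti t0) /g mul0r addr0.
have Tub : ubound T 1 by move=> s [/andP[]].
have Tsup : has_sup T by split; [exists 0|exists 1].
set S := sup T.
have S1 : S <= 1 by apply: ge_sup => //; exists 0.
have S0 : 0 <= S by exact: (ub_le_sup (ex_intro _ 1 Tub)).
have below t : 0 <= t -> t < S -> f (g t) = 0.
  move=> t0 /(sup_gt Tsup.1) [s [_ sP] ts]; apply: sP.
  by rewrite t0 ltW.
have [||r r0 rP] := ball (g S).
- by apply: gI; rewrite S0.
(* Zeros accumulate at g(S): by hypothesis if S = 0, otherwise through the earlier points g(S -
   d). *)
- move=> e e0; have [S00|Sn0] := eqVneq S 0.
    by have := facc _ e0; rewrite S00 /g mul0r addr0.
  have S_gt0 : 0 < S by rewrite lt_neqAle eq_sym Sn0.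
  pose d := Num.min S (e / D).
  have d0 : 0 < d by rewrite lt_min S_gt0 divr_gt0.
  have Nd : S - d - S = - d by ring.
  exists (g (S - d) - g S); split.
  + by rewrite gB Nd -normc_gt0 normcM normc_real mulr_gt0 // normr_gt0 oppr_eq0 gt_eqF.
  + rewrite gB Nd normcM normc_real normrN gtr0_norm //.
    by rewrite -ler_pdivlMr // /d ge_min lexx orbT.
  + by rewrite addrC subrK below ?subr_ge0 /d ?ge_min ?lexx // ltrBlDr ltrDl.
have near s : `|s - S| <= r / D -> f (g s) = 0.
  move=> sS; rewrite -[g s](subrK (g S)) addrC; apply: rP.
  by rewrite gB normcM normc_real -ler_pdivlMr.
have [S_eq1|Sn1] := eqVneq S 1.
  by rewrite -g1 near // S_eq1 subrr normr0 divr_ge0 // ltW.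
have SL1 : S < 1 by rewrite lt_neqAle Sn1.
pose s := Num.min 1 (S + r / D).
have rD : 0 < r / D by rewrite divr_gt0.
have Ss : S < s by rewrite lt_min SL1 ltrDl.
have : T s.
  split; first by rewrite (le_trans S0 (ltW Ss)) /s ge_min lexx.
  move=> t /andP[t0 ts]; case: (ltP t S) => [|St]; first exact: below.
  apply: near; rewrite ger0_norm ?subr_ge0 // lerBlDl.
  by apply: le_trans ts _; rewrite ge_min lexx orbT.
by move=> /(ub_le_sup (ex_intro _ 1 Tub)); rewrite leNgt Ss.
Qed.

Lemma cintegrable_resolventX mu z k : 0 < complex.Im z ->
  cintegrable mu (fun x => (z - x%:C)^-1 ^+ k).
Proof.
move=> z0; apply: (@cintegrable_bounded _ _ _ ((complex.Im z)^-1 ^+ k)).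
  by apply: cmeasurableX; exact: cmeasurable_resolvent.
move=> x; rewrite normcX lerXn2r ?nnegrE ?normc_ge0 ?invr_ge0 ?(ltW z0) //.
exact: normc_resolvent_le.
Qed.

(** The geometric expansion of the resolvent around z has a remainder uniform in x, so it can be
    integrated. The Taylor coefficients are integrals of powers of the resolvent. *)
Lemma cauchy_expansion mu z n h : 0 < complex.Im z -> normc h <= complex.Im z / 2 ->
  normc (cauchy_transform mu (z + h) -
    \sum_(k < n) (- h) ^+ k * complex_integral mu (fun x => (z - x%:C)^-1 ^+ k.+1)) <=
  2^-1 ^+ n * (4 / complex.Im z).
Proof.
move=> z0 hz.
have zh0 : 0 < complex.Im (z + h) by apply: lt_le_trans (Im_gt0_near z0 hz); rewrite divr_gt0.
have iF k : cintegrable mu (fun x => (- h) ^+ k * (z - x%:C)^-1 ^+ k.+1).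
  by apply: cintegrableZ; exact: cintegrable_resolventX.
have [iS ES] := @cintegral_sum _ mu n (fun k x => (- h) ^+ k * (z - x%:C)^-1 ^+ k.+1) iF.
have -> : \sum_(k < n) (- h) ^+ k * complex_integral mu (fun x => (z - x%:C)^-1 ^+ k.+1) =
    \sum_(k < n) complex_integral mu (fun x => (- h) ^+ k * (z - x%:C)^-1 ^+ k.+1).
  by apply: eq_bigr => k _; rewrite cintegralZ //; exact: cintegrable_resolventX.
rewrite -ES -cintegralB //; last exact: cintegrable_resolvent.
have -> : 2^-1 ^+ n * (4 / complex.Im z) = 2 * (2^-1 ^+ n * (2 / complex.Im z)) by field; rewrite gt_eqF.
apply: normc_cintegral_bounded.
  by apply: cintegrableB => //; exact: cintegrable_resolvent.
move=> x; have zx0 := resolvent_neq0 x z0; have zx := normc_sub_real_ge z x.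
have -> : z + h - x%:C = (z - x%:C) + h by ring.
have -> : \sum_(k < n) (- h) ^+ k * (z - x%:C)^-1 ^+ k.+1 =
    \sum_(k < n) (- h) ^+ k / (z - x%:C) ^+ k.+1.
  by apply: eq_bigr => k _; rewrite exprVn.
apply: le_trans (geometric_remainder n zx0 _) _.
  by apply: le_trans hz _; rewrite ler_wpM2r ?invr_ge0.
rewrite ler_wpM2l ?exprn_ge0 ?invr_ge0 // ler_wpM2l //.
by rewrite lef_pV2 ?posrE // (lt_le_trans z0).
Qed.

Lemma papprox_cauchy mu z : 0 < complex.Im z ->
  papprox (fun h => cauchy_transform mu (z + h)) (complex.Im z / 2).
Proof.
move=> z0 e e0.
have [n nP] := geometric_small (divr_gt0 e0 (divr_gt0 (ltr0Sn _ 3) z0)).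
exists (\sum_(k < n) (- 'X) ^+ k *
  (complex_integral mu (fun x => (z - x%:C)^-1 ^+ k.+1))%:P) => h hz.
rewrite horner_sum.
under eq_bigr do rewrite hornerM hornerC horner_exp hornerN hornerX.
apply: le_trans (cauchy_expansion mu n z0 hz) _.
by rewrite -ler_pdivlMr // divr_gt0.
Qed.

(* Subordination function of the (n+1)-st free power [lam] of [mu]:
   F_lam = F_mu o subord, i.e. (n+1) subord z = z + n F_lam z. *)
Definition subord lam n z : R[i] := (z + n%:R * recip_cauchy lam z) / n.+1%:R.

Lemma subord_mul lam n z : n.+1%:R * subord lam n z = z + n%:R * recip_cauchy lam z.
Proof. by rewrite /subord mulrC divfK // pnatr_eq0. Qed.

Lemma Im_subord_ge lam n z : 0 < complex.Im z ->
  complex.Im z <= complex.Im (subord lam n z).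
Proof.
move=> z0; rewrite /subord Im_divn Im_add Im_natmul ler_pdivlMr ?ltr0n //.
rewrite -natr1 mulrDr mulr1 addrC lerD2l mulrC ler_wpM2l //.
exact: Im_recip_cauchy_ge.
Qed.

(** A chain of compositions: G_lam, inversion (as G_lam z is nonzero), an affine map, then G_mu.
    Continuity shrinks the radius until the values stay in the disc where the next map is
    approximable. *)
Lemma papprox_subord mu lam n z : 0 < complex.Im z ->
  exists2 r, 0 < r &
    papprox (fun h => cauchy_transform lam (z + h) -
                      cauchy_transform mu (subord lam n (z + h))) r.
Proof.
move=> z0; have G0 := cauchy_neq0 lam z0.
have y0 : 0 < complex.Im z / 2 by rewrite divr_gt0.
have app1 := papprox_cauchy lam z0.
have G1 : 0 < normc (cauchy_transform lam z) / 2 by rewrite divr_gt0 // normc_gt0.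
have [r1 [r10 r1y r1P]] := papprox_cont y0 app1 G1.
rewrite addr0 in r1P.
have app2 : papprox (fun h => recip_cauchy lam (z + h)) r1.
  apply: (papprox_comp (g := GRing.inv) (papprox_le r1y app1) r1P).
  exact: papprox_inv.
have app3 : papprox (fun h => subord lam n (z + h)) r1.
  apply: papproxM; last exact: papprox_cst.
  apply: papproxD; last by apply: papproxM => //; exact: papprox_cst.
  by apply: papproxD; [exact: papprox_cst|exact: papprox_id].
have w0 : 0 < complex.Im (subord lam n z) by rewrite (lt_le_trans z0) ?Im_subord_ge.
have w1 : 0 < complex.Im (subord lam n z) / 2 by rewrite divr_gt0.
have [r2 [r20 r21 r2P]] := papprox_cont r10 app3 w1.
rewrite addr0 in r2P.
exists r2 => //.
apply: papproxD; first exact: papprox_le (le_trans r21 r1y) app1.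
apply: papprox_eq (fun h _ => mulN1r _) _.
apply: papproxM; first exact: papprox_cst.
apply: (papprox_comp (g := cauchy_transform mu) (papprox_le r21 app3) r2P).
exact: papprox_cauchy.
Qed.

End IdentityTheorem.

(** * Cauchy transforms near i*infinity *)

Section TailEstimate.
Context {R : realType}.
Implicit Types (mu : borel_prob R) (Z W : R[i]) (x y : R).

(** Bounds |x/(Z - x)| for Z within y/2 of iy: |Z - x| >= y/2 gives the second term, and |Z/(Z - x)|
    <= 3 gives the cap 4. Thanks to the cap, its integral tends to 0 as y grows for every
    probability measure. *)
Definition tail y x : R := Num.min 4 (2 * `|x| / y).

Lemma tail_ge0 y x : 0 < y -> 0 <= tail y x.
Proof. by move=> y0; rewrite le_min divr_ge0 ?mulr_ge0 // ltW. Qed.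

Lemma measurable_tail y : measurable_fun [set: measurableTypeR R] (tail y).
Proof.
apply: measurable_minr; first exact: measurable_cst.
apply: measurable_funM; last exact: measurable_cst.
by apply: measurable_funM; [exact: measurable_cst|exact: normr_measurable].
Qed.

Lemma rintegrable_tail mu y : 0 < y -> rintegrable mu (tail y).
Proof.
move=> y0; apply: (@bounded_rintegrable _ _ _ 4); first exact: measurable_tail.
by move=> x; rewrite ger0_norm ?tail_ge0 // ge_min lexx.
Qed.

Lemma tail_cvg mu : (fun n => \int[mu]_x tail n.+1%:R x) @ \oo --> (0 : R).
Proof.
have [] := @dominated_convergence _ _ _ mu setT measurableT
  (fun n x => (tail n.+1%:R x)%:E) (fun=> 0%E) (fun=> 4%:E).
- by move=> n; apply/measurable_EFinP; exact: measurable_tail.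
- exact: measurable_cst.
- apply: aeW => x _; apply/fine_cvgP; split; first exact: nearW.
  apply: (@squeeze_cvgr _ _ _ _ (fun=> 0) (fun n : nat => 2 * `|x| * n.+1%:R^-1)).
  + by apply: nearW => n; rewrite tail_ge0 //= ge_min lexx orbT.
  + exact: cvg_cst.
  + rewrite -[X in _ --> X](mulr0 (2 * `|x|)); apply: cvgM; first exact: cvg_cst.
    exact: cvg_harmonic.
- exact: (rintegrable_cst mu 4).
- apply: aeW => x n _; rewrite /= lee_fin ger0_norm ?tail_ge0 //.
  by rewrite ge_min lexx.
by move=> _ _; rewrite integral0 => /fine_cvg; apply.
Qed.

Lemma tail_small mu e : 0 < e -> exists2 M, 0 < M &
  forall y, M <= y -> \int[mu]_x tail y x <= e.
Proof.
move=> e0; have := cvgr_le _ (@tail_cvg mu) _ e0 => -[n _ /(_ n (leqnn n))] H.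
exists n.+1%:R => [//|y ny]; apply: le_trans H.
have y0 : 0 < y by apply: lt_le_trans ny.
apply: le_Rintegral => //; [exact: rintegrable_tail..|move=> x _].
rewrite le_min !ge_min lexx /=; apply/orP; right.
by rewrite ler_wpM2l ?mulr_ge0 // lef_pV2 ?posrE.
Qed.

Lemma disc_Im_ge y Z : normc (Z - (0 +i* y)) <= y / 2 -> y / 2 <= complex.Im Z.
Proof.
move=> Zy; have := le_trans (Im_le_normc _) Zy.
by rewrite Im_sub /= ler_norml => /andP[? _]; lra.
Qed.

Lemma resolvent_tail y Z x : 0 < y -> normc (Z - (0 +i* y)) <= y / 2 ->
  normc (x%:C / (Z - x%:C)) <= tail y x.
Proof.
move=> y0 Zy; have IZ := disc_Im_ge Zy.
have Z0 : 0 < complex.Im Z by apply: lt_le_trans IZ; rewrite divr_gt0.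
have Zx0 := resolvent_neq0 x Z0.
have rZ : normc (Z - x%:C)^-1 <= 2 / y.
  by rewrite (le_trans (normc_resolvent_le _ Z0)) // -invf_div lef_pV2 ?posrE ?divr_gt0.
rewrite le_min; apply/andP; split.
  have -> : x%:C / (Z - x%:C) = Z / (Z - x%:C) - 1 by field.
  apply: le_trans (normcB _ _) _; rewrite normc1 normcM.
  have NZ : normc Z <= 3 / 2 * y.
    have := normc_triangle (0 +i* y) Z 0; rewrite !subr0 => /le_trans; apply.
    by rewrite [normc (0 +i* y)]normcE /= expr0n add0r sqrtr_sqr gtr0_norm //; lra.
  have : normc Z * normc (Z - x%:C)^-1 <= 3 / 2 * y * (2 / y).
    by rewrite ler_pM ?normc_ge0.
  have -> : 3 / 2 * y * (2 / y) = 3 by field; rewrite gt_eqF.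
  lra.
rewrite normcM normc_real mulrAC [2 / y * _]mulrC ler_wpM2l //.
Qed.

Lemma cauchy_near_inv mu y Z (t := \int[mu]_x tail y x) :
  0 < y -> normc (Z - (0 +i* y)) <= y / 2 ->
  normc (Z * cauchy_transform mu Z - 1) <= 2 * t.
Proof.
move=> y0 Zy; have IZ := disc_Im_ge Zy.
have Z0 : 0 < complex.Im Z by apply: lt_le_trans IZ; rewrite divr_gt0.
rewrite -cintegralZ; last exact: cintegrable_resolvent.
rewrite -[X in _ - X](cintegral_cst mu) -cintegralB; last 2 first.
  by apply: cintegrableZ; exact: cintegrable_resolvent.
  exact: cintegrable_cst.
apply: normc_cintegral_le; last 2 first.
- exact: rintegrable_tail.
- move=> x; have Zx0 := resolvent_neq0 x Z0.
  have -> : Z * (Z - x%:C)^-1 - 1 = x%:C / (Z - x%:C) by field.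
  exact: resolvent_tail.
apply: cintegrableB; last exact: cintegrable_cst.
by apply: cintegrableZ; exact: cintegrable_resolvent.
Qed.

Lemma cauchy_prod_near_inv mu y Z W (t := \int[mu]_x tail y x) :
  0 < y -> normc (Z - (0 +i* y)) <= y / 2 -> normc (W - (0 +i* y)) <= y / 2 ->
  normc (Z * W * complex_integral mu (fun x => (Z - x%:C)^-1 * (W - x%:C)^-1) - 1) <= 12 * t.
Proof.
move=> y0 Zy Wy; have IZ := disc_Im_ge Zy; have IW := disc_Im_ge Wy.
have Z0 : 0 < complex.Im Z by apply: lt_le_trans IZ; rewrite divr_gt0.
have W0 : 0 < complex.Im W by apply: lt_le_trans IW; rewrite divr_gt0.
have iZW := cintegrable_resolventM mu Z0 W0.
rewrite -cintegralZ // -[X in _ - X](cintegral_cst mu) -cintegralB; last 2 first.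
- exact: cintegrableZ.
- exact: cintegrable_cst.
have -> : 12 * t = 2 * \int[mu]_x (6 * tail y x).
  by rewrite RintegralZl ?mulrA -?natrM //; exact: rintegrable_tail.
apply: normc_cintegral_le.
- apply: cintegrableB; last exact: cintegrable_cst.
  exact: cintegrableZ.
- by apply: rintegrableZ; exact: rintegrable_tail.
move=> x; have Zx0 := resolvent_neq0 x Z0; have Wx0 := resolvent_neq0 x W0.
have tZ := resolvent_tail x y0 Zy; have tW := resolvent_tail x y0 Wy.
(* This is (1 + a)(1 + b) - 1 with a = x/(Z - x) and b = x/(W - x); as |a| <= 4, the three terms
   total at most 6 times the tail. *)
have -> : Z * W * ((Z - x%:C)^-1 * (W - x%:C)^-1) - 1 =
  x%:C / (Z - x%:C) + x%:C / (W - x%:C) + x%:C / (Z - x%:C) * (x%:C / (W - x%:C)).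
  by field; apply/andP.
apply: le_trans (normcD _ _) _; rewrite normcM.
have := normcD (x%:C / (Z - x%:C)) (x%:C / (W - x%:C)).
have : normc (x%:C / (Z - x%:C)) * normc (x%:C / (W - x%:C)) <= 4 * tail y x.
  apply: ler_pM; rewrite ?normc_ge0 //.
  by rewrite (le_trans tZ) // ge_min lexx.
lra.
Qed.

(** By the resolvent identity, (F(Z) - F(W))/(Z - W) is E/(G(Z) G(W)) with E the integral of the
    product of resolvents. Once the tail is small, this quotient is close to 1 on the whole disc. *)
Lemma recip_expanding mu : exists2 M, 0 < M & forall y Z W, M <= y ->
  normc (Z - (0 +i* y)) <= y / 2 -> normc (W - (0 +i* y)) <= y / 2 ->
  normc (Z - W) <= 2 * normc (recip_cauchy mu Z - recip_cauchy mu W).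
Proof.
have e0 : 0 < 100^-1 :> R by [].
have [M M0 MP] := tail_small mu e0.
exists M => // y Z W My Zy Wy; have y0 : 0 < y by apply: lt_le_trans My.
have IZ := disc_Im_ge Zy; have IW := disc_Im_ge Wy.
have Z0 : 0 < complex.Im Z by apply: lt_le_trans IZ; rewrite divr_gt0.
have W0 : 0 < complex.Im W by apply: lt_le_trans IW; rewrite divr_gt0.
have := cauchy_near_inv mu y0 Zy; have := cauchy_near_inv mu y0 Wy.
have := cauchy_prod_near_inv mu y0 Zy Wy; have := MP _ My.
have := cauchy_diff mu Z0 W0; have A0 := cauchy_neq0 mu Z0; have B0 := cauchy_neq0 mu W0.
rewrite /recip_cauchy.
move: (cauchy_transform mu Z) (cauchy_transform mu W) (complex_integral mu _) A0 B0 => A B E A0 B0 AB.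
move: (\int[mu]_x _) => t t1 HE HB HA.
have Zn0 : Z != 0 by apply: contraTneq Z0 => ->; rewrite ltxx.
have Wn0 : W != 0 by apply: contraTneq W0 => ->; rewrite ltxx.
have key : (A^-1 - B^-1) * (Z * A * (W * B)) = (Z - W) * (Z * W * E).
  have -> : (A^-1 - B^-1) * (Z * A * (W * B)) = - (Z * W * (A - B)) by field; apply/andP.
  by rewrite AB; ring.
have nA : normc (Z * A) <= 102 / 100.
  by rewrite -(subrK 1 (Z * A)) (le_trans (normcD _ _)) // normc1; lra.
have nB : normc (W * B) <= 102 / 100.
  by rewrite -(subrK 1 (W * B)) (le_trans (normcD _ _)) // normc1; lra.
have nE : 88 / 100 <= normc (Z * W * E).
  have := normc_rev 1 (Z * W * E); rewrite normc1 normcC; lra.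
have eqn : normc (A^-1 - B^-1) * normc (Z * A * (W * B)) = normc (Z - W) * normc (Z * W * E).
  by rewrite -2!normcM key.
have pB : normc (Z * A * (W * B)) <= 102 / 100 * (102 / 100).
  by rewrite normcM ler_pM ?normc_ge0.
have fin (a b p q : R) : 88 / 100 <= q -> b * p = a * q -> p <= 102 / 100 * (102 / 100) ->
    0 <= b -> 0 <= a -> a <= 2 * b by move=> *; nra.
exact: (fin _ _ _ _ nE eqn pB (normc_ge0 _) (normc_ge0 _)).
Qed.

End TailEstimate.

(** * Voiculescu transforms of free powers and the subordination equation *)

Section FreePower.
Context {R : realType}.
Implicit Types (mu nu lam : borel_prob R) (phi psi : R -> R[i]) (y : R).

(* Restriction of a Voiculescu transform to the imaginary axis, near infinity. *)
Definition vinv mu phi := forall e : R, 0 < e -> exists2 M, 0 < M &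
  forall y, M < y -> [/\ normc (phi y) <= e * y, 0 < complex.Im (0 +i* y + phi y) &
                         recip_cauchy mu (0 +i* y + phi y) = 0 +i* y].

Lemma normc_imaginary y : 0 <= y -> normc (0 +i* y) = y.
Proof. by move=> y0; rewrite normcE /= expr0n add0r sqrtr_sqr ger0_norm. Qed.

Lemma is_voiculescu_vinv mu a b (phi : R[i] -> R[i]) : 0 < a -> 0 < b ->
  is_voiculescu mu a b phi -> vinv mu (fun y => phi (0 +i* y)).
Proof.
move=> a0 b0 [inv small] e /small[N NP]; exists (Num.max b N); first by rewrite lt_max b0.
move=> y; rewrite gt_max => /andP[yb yN].
have y0 : 0 < y by apply: lt_trans yb.
have st : stolz a b (0 +i* y) by split=> //=; rewrite normr0 mulr_gt0.
have [I E] := inv _ st; split=> //.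
have := NP _ st yN; rewrite !normc_norm normc_imaginary ?(ltW y0) //.
by rewrite -rmorphM lecR.
Qed.

(** Being o(y), both transforms leave the preimages of iy in the disc of radius y/2 about iy, where
    F is injective. *)
Lemma vinv_unique mu phi psi : vinv mu phi -> vinv mu psi ->
  exists M, forall y, M < y -> phi y = psi y.
Proof.
move=> v1 v2; have h0 : 0 < 2^-1 :> R by rewrite invr_gt0.
have [[M1 M10 M1P] [M2 M20 M2P]] := (v1 _ h0, v2 _ h0).
have [M M0 MP] := recip_expanding mu.
exists (Num.max M (Num.max M1 M2)) => y; rewrite !gt_max => /and3P[yM yM1 yM2].
have [[n1 _ F1] [n2 _ F2]] := (M1P _ yM1, M2P _ yM2).
have := MP y (0 +i* y + phi y) (0 +i* y + psi y) (ltW yM).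
rewrite F1 F2 subrr normc0 mulr0 [0 +i* y + phi y]addrC [0 +i* y + psi y]addrC !addrK.
move=> /(_ _ _) H.
have : normc (phi y + 0 +i* y - (psi y + 0 +i* y)) <= 0 by apply: H; rewrite mulrC.
rewrite opprD addrACA subrr addr0 => D0.
apply/eqP; rewrite -subr_eq0 -normc_eq0 eq_le D0 normc_ge0 //.
Qed.

Lemma vinv_eventually mu phi psi : vinv mu phi ->
  (exists M, forall y, M < y -> phi y = psi y) -> vinv mu psi.
Proof.
move=> v [N NP] e /v[M M0 MP]; exists (Num.max M N); first by rewrite lt_max M0.
by move=> y; rewrite gt_max => /andP[yM yN]; rewrite -NP //; exact: MP.
Qed.

Lemma free_conv_vinv mu nu lam : is_free_conv mu nu lam -> exists phi psi,
  [/\ vinv mu phi, vinv nu psi & vinv lam (fun y => phi y + psi y)].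
Proof.
move=> [a [b [phi [psi [a0 b0 v1 v2 v3]]]]].
exists (fun y => phi (0 +i* y)), (fun y => psi (0 +i* y)).
by split; [exact: is_voiculescu_vinv v1|exact: is_voiculescu_vinv v2|exact: is_voiculescu_vinv v3].
Qed.

(** Each convolution step comes with its own cone and its own transforms; [vinv_unique] matches them
    near infinity, and the transforms add up. *)
Lemma free_power_vinv mu n lam phi : is_free_power mu n lam ->
  vinv mu phi -> vinv lam (fun y => n%:R * phi y).
Proof.
move=> pw; elim: pw phi => [|{}n nu {}lam _ IH /free_conv_vinv[f [g [vf vg vfg]]]] phi v.
  by apply: vinv_eventually v _; exists 0 => y _; rewrite mul1r.
have [M1 M1P] := vinv_unique (IH _ v) vf; have [M2 M2P] := vinv_unique v vg.
apply: vinv_eventually vfg _; exists (Num.max M1 M2) => y.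
by rewrite gt_max => /andP[y1 y2]; rewrite -M1P // -M2P // -natr1 mulrDl mul1r.
Qed.

(** At chi(y) = iy + (n+2) phi(y) the reciprocal transform of [lam] is iy and the subordination
    point is iy + phi(y), which that of [mu] also sends to iy. So the equation holds along a curve,
    and the identity theorem spreads it. *)
Lemma free_power_subordination mu n lam : is_free_power mu n.+2 lam ->
  forall z, 0 < complex.Im z ->
    cauchy_transform lam z = cauchy_transform mu (subord lam n.+1 z).
Proof.
move=> pw.
have [phi vphi] : exists phi, vinv mu phi.
  (* A power of index at least 2 is a convolution with second factor [mu], which supplies a
     transform of [mu]. *)
  by inversion pw; have [f [g [_ vg _]]] := free_conv_vinv H1; exists g.
have vlam := free_power_vinv pw vphi.
have e0 : 0 < 8^-1 :> R by rewrite invr_gt0.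
have [[M1 M10 M1P] [M2 M20 M2P]] := (vphi _ e0, vlam _ e0).
have [M3 M30 M3P] := recip_expanding lam.
pose y0 := Num.max M1 (Num.max M2 M3) + 1.
have y0P y : y0 <= y -> [/\ M1 < y, M2 < y & M3 <= y].
  move=> yy0; have : Num.max M1 (Num.max M2 M3) < y.
    by apply: lt_le_trans yy0; rewrite ltrDl.
  by rewrite !gt_max => /and3P[? ? ?]; split=> //; exact: ltW.
pose chi y := 0 +i* y + n.+2%:R * phi y.
have zero y : y0 <= y -> 0 < complex.Im (chi y) /\
    cauchy_transform lam (chi y) - cauchy_transform mu (subord lam n.+1 (chi y)) = 0.
  move=> /y0P[y1 y2 y3]; have [_ I1 F1] := M1P _ y1; have [_ I2 F2] := M2P _ y2.
  split=> //; have -> : subord lam n.+1 (chi y) = 0 +i* y + phi y.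
    rewrite /subord F2 /chi.
    apply: (mulIf (_ : n.+2%:R != 0 :> R[i])); first by rewrite pnatr_eq0.
    by rewrite divfK ?pnatr_eq0 // -!natr1; ring.
  by rewrite -!recip_cauchyV F1 F2 subrr.
move=> z z0; apply/eqP; rewrite -subr_eq0; apply/eqP.
have [I0 E0] := zero _ (lexx y0).
have y00 : 0 < y0 by rewrite ltr_wpDl // le_max (ltW M10).
apply: (upper_identity (f := fun z => cauchy_transform lam z -
  cauchy_transform mu (subord lam n.+1 z)) _ I0) => //.
  by move=> w w0; exact: papprox_subord.
(* [e / 2] offsets the factor 2 of [recip_expanding]; [y0 / 4] keeps chi(y0 + d) within y0/2 of i
   y0, since chi(y) is within y/8 of iy. *)
move=> e e_gt0; pose d := Num.min (e / 2) (y0 / 4).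
have d0 : 0 < d by rewrite lt_min !divr_gt0.
have dy : d <= y0 / 4 by rewrite ge_min lexx orbT.
have de : d <= e / 2 by rewrite ge_min lexx.
have yd : y0 <= y0 + d by rewrite lerDl ltW.
have [y1 y2 y3] := y0P _ (lexx y0); have [x1 x2 x3] := y0P _ yd.
have [N1 _ F1] := M2P _ y2; have [N2 _ F2] := M2P _ x2.
have im_diff : (0 +i* (y0 + d)) - (0 +i* y0) = 0 +i* d.
  by rewrite -[LHS]/((0 - 0) +i* (y0 + d - y0)) subrr addrAC subrr add0r.
exists (chi (y0 + d) - chi y0); split.
- apply/eqP => /eqP; rewrite subr_eq0 => /eqP E.
  have : recip_cauchy lam (chi (y0 + d)) = recip_cauchy lam (chi y0) by rewrite E.
  rewrite /chi F1 F2 => -[] /eqP; rewrite -subr_eq0 addrAC subrr add0r.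
  by rewrite gt_eqF.
- have : normc (chi (y0 + d) - chi y0) <= 2 * normc (0 +i* (y0 + d) - 0 +i* y0).
    rewrite -F2 -F1; apply: (M3P y0) => //; last by rewrite addrC addKr; lra.
    rewrite addrAC im_diff; apply: le_trans (normcD _ _) _.
    rewrite normc_imaginary ?(ltW d0) //; lra.
  by rewrite im_diff normc_imaginary ?(ltW d0) //; lra.
- by rewrite (_ : chi y0 + _ = chi (y0 + d)) ?(zero _ yd).2 // addrC subrK.
Qed.

End FreePower.

(** * Inverting the subordination function *)

Section Variance.
Context {R : realType}.
Variable mu : borel_prob R.
Hypothesis mu2 : rintegrable mu (fun x => x ^+ 2).
Implicit Types (Z W : R[i]) (x : R).

Let m := moment mu 1.
Let s2 := moment mu 2 - moment mu 1 ^+ 2.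

Lemma rintegrable_id : rintegrable mu (fun x => x).
Proof.
apply: (@le_rintegrable _ _ _ (fun x => 1 + x ^+ 2)).
- exact: measurable_id.
- move=> x; rewrite -[x ^+ 2]real_normK ?num_real //.
  by have := sqr_ge0 (`|x| - 1); nra.
- by apply: rintegrableD => //; exact: rintegrable_cst.
Qed.

Lemma rintegrable_center : rintegrable mu (fun x => x - m).
Proof. exact: rintegrableD rintegrable_id (rintegrable_cst mu (- m)). Qed.

Lemma rintegrable_center_sqr : rintegrable mu (fun x => (x - m) ^+ 2).
Proof.
apply: eq_integrable (rintegrableD mu2 (rintegrableD
  (rintegrableZ (- 2 * m) rintegrable_id) (rintegrable_cst mu (m ^+ 2)))) => // x _.
by rewrite /=; congr _%:E; ring.
Qed.

Lemma Rintegral_center : \int[mu]_x (x - m) = 0.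
Proof.
rewrite RintegralB //; [|exact: rintegrable_id|exact: rintegrable_cst].
by rewrite Rintegral_prob_cst /m /moment subrr.
Qed.

Lemma Rintegral_center_sqr : \int[mu]_x ((x - m) ^+ 2) = s2.
Proof.
transitivity (\int[mu]_x (x ^+ 2 + ((- 2 * m) * x + m ^+ 2))).
  by apply: eq_Rintegral => x _; ring.
have i1 := rintegrableZ (- 2 * m) rintegrable_id.
have i2 := rintegrable_cst mu (m ^+ 2).
rewrite RintegralD //; last exact: rintegrableD.
rewrite RintegralD // RintegralZl //; last exact: rintegrable_id.
rewrite Rintegral_prob_cst /s2 -/m.
have -> : \int[mu]_x x = m by [].
by rewrite /moment; ring.
Qed.

Lemma variance_ge0 : 0 <= s2.
Proof. by rewrite -Rintegral_center_sqr Rintegral_ge0 // => x _; rewrite sqr_ge0. Qed.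

Lemma cintegrable_center_sqr (f : R -> R[i]) (b : R) : 0 <= b -> cmeasurable f ->
  (forall x, normc (f x) <= b) ->
  cintegrable mu (fun x => ((x - m) ^+ 2)%:C * f x) /\
  normc (complex_integral mu (fun x => ((x - m) ^+ 2)%:C * f x)) <= 2 * (b * s2).
Proof.
move=> b0 mf fb.
have iv := rintegrableZ b rintegrable_center_sqr.
have bnd x : normc (((x - m) ^+ 2)%:C * f x) <= b * (x - m) ^+ 2.
  by rewrite normcM normc_real ger0_norm ?sqr_ge0 // mulrC ler_wpM2r ?sqr_ge0.
have i1 : cintegrable mu (fun x => ((x - m) ^+ 2)%:C * f x).
  apply: cintegrable_le iv bnd; apply: cmeasurableM => //.
  apply: cmeasurable_real; apply: measurable_funX.
  by apply: measurable_funB; [exact: measurable_id|exact: measurable_cst].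
split=> //; rewrite -Rintegral_center_sqr -RintegralZl //; last exact: rintegrable_center_sqr.
exact: normc_cintegral_le.
Qed.

Lemma center_neq0 Z : 0 < complex.Im Z -> Z - m%:C != 0.
Proof. exact: resolvent_neq0. Qed.

(** With w = Z - m and u = x - m, one has w^2/(w - u) - w - u = u^2/(w - u), and u has mean zero;
    only a variance term remains. *)
Lemma cauchy_center Z : 0 < complex.Im Z ->
  normc (Z - m%:C) * normc ((Z - m%:C) * cauchy_transform mu Z - 1) <= 2 * ((complex.Im Z)^-1 * s2).
Proof.
move=> Z0; set w := Z - m%:C; rewrite -normcM.
have iR := cintegrable_resolvent mu Z0.
have ic : cintegrable mu (fun x => (x - m)%:C).
  split; first exact: rintegrable_center.
  exact: rintegrable_cst.
have c0 : complex_integral mu (fun x => (x - m)%:C) = 0.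
  by rewrite /complex_integral /= Rintegral_center Rintegral_prob_cst.
have -> : w * (w * cauchy_transform mu Z - 1) =
    complex_integral mu (fun x => ((x - m) ^+ 2)%:C * (Z - x%:C)^-1).
  have iw := cintegrable_cst mu w; have iz := cintegrableZ (w ^+ 2) iR.
  transitivity (complex_integral mu (fun x => w ^+ 2 * (Z - x%:C)^-1 - w - (x - m)%:C)).
    rewrite (cintegralB (cintegrableB iz iw) ic) (cintegralB iz iw) cintegralZ //.
    by rewrite cintegral_cst c0 /cauchy_transform; ring.
  apply: eq_cintegral => x; have := resolvent_neq0 x Z0; rewrite /w.
  by rewrite rmorphXn !rmorphB /= => ?; field.
apply: (cintegrable_center_sqr _ _ _).2.
- by rewrite invr_ge0 ltW.
- exact: cmeasurable_resolvent.
- by move=> x; exact: normc_resolvent_le.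
Qed.

(** With a = w/(Z - x) and b = v/(W - x), the integrand is (a - 1)(b - 1), which is of second order
    in x - m. *)
Lemma cauchy_prod_center Z W (w := Z - m%:C) (v := W - m%:C) :
  0 < complex.Im Z -> 0 < complex.Im W ->
  normc (w * v * complex_integral mu (fun x => (Z - x%:C)^-1 * (W - x%:C)^-1) -
         1 - (w * cauchy_transform mu Z - 1) - (v * cauchy_transform mu W - 1)) <=
  2 * ((complex.Im Z)^-1 * (complex.Im W)^-1 * s2).
Proof.
move=> Z0 W0; have iZ := cintegrable_resolvent mu Z0; have iW := cintegrable_resolvent mu W0.
have iZW := cintegrable_resolventM mu Z0 W0; have i1 := cintegrable_cst mu 1.
have -> : w * v * complex_integral mu (fun x => (Z - x%:C)^-1 * (W - x%:C)^-1) -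
         1 - (w * cauchy_transform mu Z - 1) - (v * cauchy_transform mu W - 1) =
   complex_integral mu (fun x => ((x - m) ^+ 2)%:C * ((Z - x%:C)^-1 * (W - x%:C)^-1)).
  have iz := cintegrableB (cintegrableZ w iZ) i1; have iw := cintegrableB (cintegrableZ v iW) i1.
  have izw := cintegrableB (cintegrableZ (w * v) iZW) i1.
  transitivity (complex_integral mu (fun x => w * v * ((Z - x%:C)^-1 * (W - x%:C)^-1) - 1 -
      (w * (Z - x%:C)^-1 - 1) - (v * (W - x%:C)^-1 - 1))).
    rewrite (cintegralB (cintegrableB izw iz) iw) (cintegralB izw iz).
    rewrite (cintegralB (cintegrableZ (w * v) iZW) i1) (cintegralB (cintegrableZ w iZ) i1).
    by rewrite (cintegralB (cintegrableZ v iW) i1) !cintegralZ // cintegral_cst.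
  apply: eq_cintegral => x; have := resolvent_neq0 x Z0; have := resolvent_neq0 x W0.
  rewrite /w /v rmorphXn !rmorphB /= => ? ?; field.
  by apply/andP.
apply: (cintegrable_center_sqr _ _ _).2.
- by rewrite mulr_ge0 // invr_ge0 ltW.
- by apply: cmeasurableM; exact: cmeasurable_resolvent.
- by move=> x; rewrite normcM ler_pM ?normc_ge0 ?normc_resolvent_le.
Qed.

Variable n : nat.

Lemma variance_ratio y : 0 < y -> 100 * n.+1%:R * s2 <= y ^+ 2 ->
  y^-1 * s2 <= y / (100 * n.+1%:R).
Proof.
move=> y0 hy; rewrite ler_pdivlMr ?mulr_gt0 ?ltr0n // -mulrA ler_pdivrMl //.
by rewrite mulrC -expr2.
Qed.

(** The errors must be of order 1/n, because [free_push] multiplies F by n. This is where the height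
    10 s sqrt n comes from. *)
Lemma cauchy_center_small Z (y := complex.Im Z) (w := Z - m%:C) : 0 < y ->
  100 * n.+1%:R * s2 <= y ^+ 2 ->
  normc (w * cauchy_transform mu Z - 1) <= (50 * n.+1%:R)^-1 /\
  normc w * normc (w * cauchy_transform mu Z - 1) <= y / (50 * n.+1%:R).
Proof.
move=> y0 hy; have H := cauchy_center y0; have Hr := variance_ratio y0 hy.
have N0 : 0 < n.+1%:R :> R by rewrite ltr0n.
have E : 2 * (y / (100 * n.+1%:R)) = y / (50 * n.+1%:R).
  by field; rewrite gt_eqF.
have H2 : normc w * normc (w * cauchy_transform mu Z - 1) <= y / (50 * n.+1%:R).
  rewrite -E; apply: le_trans H _; rewrite ler_wpM2l //.
split=> //; rewrite -(ler_pM2l y0); apply: le_trans H2.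
by rewrite ler_wpM2r ?normc_ge0 // /w normc_sub_real_ge.
Qed.

Lemma inv50_le : (50 * n.+1%:R)^-1 <= 50^-1 :> R.
Proof. by rewrite lef_pV2 ?posrE ?mulr_gt0 ?ltr0n // ler_peMr // ler1n. Qed.

(* Right inverse of [subord lam n] where Im Z is large compared with the standard
   deviation of the (n+1)-st free power [lam]. *)
Definition free_push Z : R[i] := n.+1%:R * Z - n%:R * recip_cauchy mu Z.

(** Im H(Z) = y - n (Im F(Z) - y), and F(Z) differs from Z - m by at most y/(49 (n+1)). *)
Lemma Im_free_push Z (y := complex.Im Z) : 0 < y -> 100 * n.+1%:R * s2 <= y ^+ 2 ->
  97 / 100 * y <= complex.Im (free_push Z).
Proof.
move=> y0 hy; have [H1 H2] := cauchy_center_small y0 hy.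
have N0 : 0 < n.+1%:R :> R by rewrite ltr0n.
have G0 := cauchy_neq0 mu y0; have w0 := center_neq0 y0.
set w := Z - m%:C in H1 H2 w0; set A := cauchy_transform mu Z in H1 H2 G0.
have nA : 49 / 50 <= normc (w * A).
  have := normc_rev 1 (w * A); rewrite normc1 normcC.
  by have := le_trans H1 inv50_le; lra.
have HF : normc (recip_cauchy mu Z - w) <= y / (49 * n.+1%:R).
  have -> : recip_cauchy mu Z - w = - (w * (w * A - 1) / (w * A)).
    by rewrite /recip_cauchy -/A; field; apply/andP.
  rewrite normcN normcM normcV normcM ler_pdivrMr; last by lra.
  apply: (le_trans H2); apply: (@le_trans _ _ (y / (49 * n.+1%:R) * (49 / 50))).
    by rewrite le_eqVlt; apply/orP; left; apply/eqP; rewrite -/y; field; rewrite gt_eqF.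
  by rewrite ler_wpM2l // divr_ge0 ?mulr_ge0 // ltW.
have HI : complex.Im (recip_cauchy mu Z) - y <= y / (49 * n.+1%:R).
  apply: le_trans HF; apply: le_trans (Im_le_normc _); apply: le_trans (ler_norm _).
  by rewrite Im_sub ImB_real.
rewrite /free_push Im_sub !Im_natmul -/y -(natr1 n).
have : n%:R * (complex.Im (recip_cauchy mu Z) - y) <= y / 49.
  apply: (@le_trans _ _ (n%:R * (y / (49 * n.+1%:R)))); first by rewrite ler_wpM2l.
  have -> : n%:R * (y / (49 * n.+1%:R)) = y / 49 * (n%:R / n.+1%:R) by field; rewrite gt_eqF.
  by rewrite ler_piMr ?divr_ge0 ?(ltW y0) // ler_pdivrMr // mul1r ler_nat.
by have := y0; lra.
Qed.

(** Dividing H(Z) = H(W) by Z - W gives P = n c, where P = wA vB is close to 1 and c is the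
    covariance under [mu] of w/(Z - x) and v/(W - x), at most 1/(10 n): a contradiction. For W only
    a height of 97/100 y is asked, since W will be a subordination point of H(Z), whose height is
    bounded through Im H(Z). *)
Lemma free_push_inj Z W (y := complex.Im Z) : 0 < y -> 100 * n.+1%:R * s2 <= y ^+ 2 ->
  97 / 100 * y <= complex.Im W -> free_push Z = free_push W -> Z = W.
Proof.
move=> y0 hy hW eqH; set y' := complex.Im W in hW.
have y'0 : 0 < y' by lra.
have N0 : 0 < n.+1%:R :> R by rewrite ltr0n.
have A0 := cauchy_neq0 mu y0; have B0 := cauchy_neq0 mu y'0.
have w0 := center_neq0 y0; have v0 := center_neq0 y'0.
have H1 := (cauchy_center_small y0 hy).1.
have H2 := cauchy_center y'0.
have H3 := cauchy_prod_center y0 y'0.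
have AB := cauchy_diff mu y0 y'0.
move: eqH; rewrite /free_push /recip_cauchy.
move: H1 H2 H3 AB A0 B0; rewrite -/y -/y'.
set w := Z - m%:C in w0 *; set v := W - m%:C in v0 *.
move: (cauchy_transform mu Z) (cauchy_transform mu W) (complex_integral mu _) => A B E.
move=> H1 H2 H3 AB A0 B0 eqH.
apply/eqP; rewrite -subr_eq0; apply/negPn/negP => ZW0.
pose P := w * A * (v * B); pose c := w * v * E - P.
have key : P = n%:R * c.
  have E1 : n.+1%:R * (Z - W) = n%:R * (A^-1 - B^-1).
    apply/eqP; rewrite -subr_eq0; move/eqP: eqH; rewrite -subr_eq0 => /eqP <-; apply/eqP; ring.
  have E2 : A^-1 - B^-1 = (Z - W) * E / (A * B).
    have -> : A^-1 - B^-1 = - (A - B) / (A * B) by field; apply/andP.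
    by rewrite AB; field; apply/andP.
  have E3 : n.+1%:R * (A * B) = n%:R * E.
    by apply: (mulfI ZW0); rewrite mulrCA mulrA E1 E2; field; apply/andP.
  have -> : n%:R * c = w * v * (n%:R * E) - n%:R * P by rewrite /c; ring.
  by rewrite -E3 -natr1 /P; ring.
have H2' : normc (v * B - 1) <= 40^-1.
  rewrite -(ler_pM2l (_ : 0 < y' * y')) ?mulr_gt0 //.
  have H : y' * normc (v * B - 1) <= 2 * (y'^-1 * s2).
    by apply: le_trans H2; rewrite ler_wpM2r ?normc_ge0 // normc_sub_real_ge.
  rewrite -mulrA; apply: le_trans (ler_wpM2l (ltW y'0) H) _.
  have -> : y' * (2 * (y'^-1 * s2)) = 2 * s2 by field; rewrite gt_eqF.
  have : 100 * s2 <= 100 * n.+1%:R * s2.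
    by rewrite ler_wpM2r ?variance_ge0 // ler_peMr // ler1n.
  nra.
have H3' : n%:R * (2 * (y^-1 * y'^-1 * s2)) <= 40^-1.
  have : 2 * (y^-1 * y'^-1 * s2) <= 40^-1 / n.+1%:R.
    rewrite ler_pdivlMr // -(ler_pM2l (_ : 0 < y * y')) ?mulr_gt0 //.
    have -> : y * y' * (2 * (y^-1 * y'^-1 * s2) * n.+1%:R) = 2 * n.+1%:R * s2.
      by field; rewrite !gt_eqF.
    nra.
  move/(ler_wpM2l (ler0n R n))/le_trans; apply.
  by rewrite mulrA ler_pdivrMr // mulrC ler_wpM2l // ler_nat.
(* The second-order term of [cauchy_prod_center], minus a product of two small errors. *)
have cE : c = (w * v * E - 1 - (w * A - 1) - (v * B - 1)) - (w * A - 1) * (v * B - 1).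
  by rewrite /c /P; ring.
have nP : 9 / 10 <= normc P.
  rewrite /P normcM.
  have a1 : 49 / 50 <= normc (w * A).
    have := normc_rev 1 (w * A); rewrite normc1 normcC.
    by have := le_trans H1 inv50_le; lra.
  have b1 : 39 / 40 <= normc (v * B).
    by have := normc_rev 1 (v * B); rewrite normc1 normcC; lra.
  nra.
have : normc P <= 1 / 10.
  rewrite key normcM normc_nat cE.
  apply: (@le_trans _ _ (n%:R * (2 * (y^-1 * y'^-1 * s2) + (50 * n.+1%:R)^-1 * 40^-1))).
    rewrite ler_wpM2l //; apply: le_trans (normcB _ _) _; rewrite normcM lerD //.
    by rewrite ler_pM ?normc_ge0.
  have H4 : n%:R * ((50 * n.+1%:R)^-1 * 40^-1) <= 50^-1 / 40 :> R.
    rewrite mulrA ler_wpM2r ?invr_ge0 // invfM mulrCA ler_piMr ?invr_ge0 //.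
    by rewrite ler_pdivrMr // mul1r ler_nat.
  by rewrite mulrDr; apply: le_trans (lerD H3' H4) _; lra.
lra.
Qed.

(** By the subordination equation [free_push] sends [subord lam n z] back to z = H(Z), so
    injectivity identifies that point with Z. *)
Lemma free_push_subord lam Z (y := complex.Im Z) (z := free_push Z) :
  (forall z, 0 < complex.Im z -> cauchy_transform lam z = cauchy_transform mu (subord lam n z)) ->
  0 < y -> 100 * n.+1%:R * s2 <= y ^+ 2 ->
  cauchy_transform lam z = cauchy_transform mu Z.
Proof.
move=> sub y0 hy; have Iz := Im_free_push y0 hy.
have z0 : 0 < complex.Im z by apply: lt_le_trans Iz; rewrite mulr_gt0.
rewrite sub //; congr cauchy_transform; apply/esym.
apply: free_push_inj => //; first exact: le_trans Iz (Im_subord_ge lam n z0).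
by rewrite -/z [RHS]/free_push subord_mul /recip_cauchy -sub // addrK.
Qed.

(** At z = H(Z), put A = G_lam(z) = G_mu(Z) and B = G_lam'(z) = G_rho(W). Then W - Z = n/(n+1) (A -
    B)/(AB) is O(y^2 |A - B|), as A and B are at least of order 1/y: for A because |Z - m| <= 4y,
    for B because [delta] is small. The Lipschitz bound for G_rho then compares G_rho(Z) with B. *)
Lemma cauchy_close_of_free_powers rho lam lam' delta Z (y := complex.Im Z) :
  (forall z, 0 < complex.Im z -> cauchy_transform lam z = cauchy_transform mu (subord lam n z)) ->
  (forall z, 0 < complex.Im z -> cauchy_transform lam' z = cauchy_transform rho (subord lam' n z)) ->
  cdf_close lam lam' delta -> delta <= 100^-1 ->
  0 < y -> 100 * n.+1%:R * s2 <= y ^+ 2 -> normc (Z - m%:C) <= 4 * y ->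
  normc (cauchy_transform mu Z - cauchy_transform rho Z) <= 600 * delta / y.
Proof.
move=> sub sub' close d100 y0 hy hw.
have d0 := cdf_close_ge0 close.
have Iz := Im_free_push y0 hy; have Gz := free_push_subord sub y0 hy.
set z := free_push Z in Iz Gz; rewrite -/y in Iz.
have z0 : 0 < complex.Im z by apply: lt_le_trans Iz; rewrite mulr_gt0.
have AB := cauchy_close close z0.
have Ww : complex.Im z <= complex.Im (subord lam' n z) by exact: Im_subord_ge.
have Eq : n.+1%:R * (subord lam' n z - Z) = n%:R * (recip_cauchy lam' z - recip_cauchy mu Z).
  by rewrite mulrBr subord_mul /z /free_push; ring.
have W0 : 0 < complex.Im (subord lam' n z) by apply: lt_le_trans Ww.
have Lip := cauchy_lipschitz rho y0 W0; rewrite -sub' // -/y in Lip.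
have A0 := cauchy_neq0 mu y0; have B0 := cauchy_neq0 lam' z0.
move: AB Eq Lip Ww W0; rewrite Gz /recip_cauchy.
have nA : 24 / 100 / y <= normc (cauchy_transform mu Z).
  have [H _] := cauchy_center_small y0 hy.
  have := normc_rev 1 ((Z - m%:C) * cauchy_transform mu Z).
  rewrite normc1 normcC normcM ler_pdivrMr // => H'.
  have := le_trans H inv50_le; have := normc_ge0 (cauchy_transform mu Z); nra.
move: (subord lam' n z) (cauchy_transform lam' z) (cauchy_transform mu Z) (cauchy_transform rho Z) A0 B0 nA.
move=> W B A C A0 B0 nA AB Eq Lip Wz W0.
have yi0 : 0 < y^-1 by rewrite invr_gt0.
have AB' : normc (A - B) <= 7 * delta / y.
  apply: le_trans AB _; rewrite ler_pdivrMr // mulrAC ler_pdivlMr //.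
  have : 0 <= delta * (complex.Im z - 97 / 100 * y) by rewrite mulr_ge0 // subr_ge0.
  have : 0 <= delta * y by rewrite mulr_ge0 // ltW.
  lra.
have nB : 12 / 100 / y <= normc B.
  have := normc_rev A B.
  have : 7 * delta / y <= 7 / 100 / y by rewrite ler_wpM2r ?(ltW yi0) //; lra.
  rewrite -!(mulrC y^-1) in nA AB' *; nra.
have WZ : normc (W - Z) <= 40 * y ^+ 2 * normc (A - B).
  have -> : W - Z = n%:R / n.+1%:R * ((A - B) / (A * B)).
    apply: (mulfI (_ : n.+1%:R != 0)); first by rewrite pnatr_eq0.
    rewrite Eq [RHS]mulrA [n.+1%:R * _]mulrCA divff ?pnatr_eq0 // mulr1; congr (_ * _).
    by field; apply/andP.
  rewrite !normcM !normcV !normcM !normc_nat.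
  have h1 : n%:R / n.+1%:R <= 1 :> R by rewrite ler_pdivrMr ?ltr0n // mul1r ler_nat.
  have h2 : normc (A - B) / (normc A * normc B) <= 40 * y ^+ 2 * normc (A - B).
    rewrite mulrC ler_wpM2r ?normc_ge0 // -[leRHS]invrK lef_pV2 ?posrE; last 2 first.
    - by rewrite mulr_gt0 // normc_gt0.
    - by rewrite invr_gt0 mulr_gt0 // exprn_gt0.
    apply: (@le_trans _ _ (24 / 100 / y * (12 / 100 / y))); last first.
      by rewrite ler_pM // !mulr_ge0 // ltW.
    have -> : (40 * y ^+ 2)^-1 = 1 / 40 * (y^-1 * y^-1) by field; rewrite gt_eqF.
    have : 0 < y^-1 * y^-1 by rewrite mulr_gt0.
    nra.
  apply: le_trans h2; rewrite ler_piMl // divr_ge0 ?normc_ge0 // mulr_ge0 ?normc_ge0 //.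
(* 2 * 40 / (97/100) is below 83; in the end (1 + 83) * 7 = 588 is rounded up to 600. *)
have Lip2 : normc (C - B) <= 83 * normc (A - B).
  apply: le_trans Lip _; rewrite ler_pdivrMr ?mulr_gt0 // normcC.
  have : y * (97 / 100 * y) <= y * complex.Im W.
    by rewrite ler_wpM2l ?(ltW y0) // (le_trans Iz).
  have := normc_ge0 (A - B); have : 0 < y ^+ 2 by rewrite exprn_gt0.
  nra.
have := normc_triangle B A C; rewrite [normc (B - C)]normcC.
have -> : 600 * delta / y = 600 / 7 * (7 * delta / y) by field; rewrite gt_eqF.
by have := normc_ge0 (A - B); lra.
Qed.

End Variance.

(** * From Cauchy transforms to characteristic functions *)

Section ExponentialKernel.
Context {R : realType}.
Implicit Types (mu rho : borel_prob R) (v x t Y : R) (a b : R[i]) (K : nat).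

(** This is e^(-iv). *)
Definition expmi v : R[i] := cos v -i* sin v.

Lemma normc_expmi v : normc (expmi v) = 1.
Proof. by rewrite normcE /= sqrrN cos2Dsin2 sqrtr1. Qed.

Lemma expmiD v x : expmi (v + x) = expmi v * expmi x.
Proof.
rewrite /expmi -[RHS]/((_ - _) +i* (_ + _)) cosD sinD.
by congr (_ +i* _); ring.
Qed.

Lemma expmiX v K : expmi v ^+ K = expmi (K%:R * v).
Proof.
elim: K => [|K IH]; first by rewrite mul0r /expmi cos0 sin0 oppr0.
by rewrite exprS IH -expmiD -(natr1 K) mulrDl mul1r addrC.
Qed.

Lemma sqr_bound_of_derive (f g : R -> R) :
  (forall x, is_derive x (1 : R) f (g x)) -> (forall x, `|g x| <= `|x|) ->
  forall v, `|f v - f 0| <= v ^+ 2.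
Proof.
move=> fg gB v; have fc : continuous f.
  by move=> x; apply/differentiable_continuous/derivable1_diffP; case: (fg x).
have [v0|v0|<-] := ltgtP 0 v; last by rewrite subrr normr0 expr0n.
- have [|c] := @MVT R f g 0 v v0 (fun x _ => fg x); first exact: continuous_subspaceT.
  rewrite in_itv /= => /andP[c0 cv] ->; rewrite subr0 normrM expr2.
  rewrite (gtr0_norm v0) ler_wpM2r ?(ltW v0) // (le_trans (gB c)) //.
  by rewrite gtr0_norm // ltW.
- have [|c] := @MVT R f g v 0 v0 (fun x _ => fg x); first exact: continuous_subspaceT.
  rewrite in_itv /= distrC => /andP[vc c0] ->; rewrite sub0r normrM normrN.
  rewrite -[v ^+ 2]real_normK ?num_real // expr2.
  rewrite ler_wpM2r // (le_trans (gB c)) //.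
  by rewrite !ltr0_norm // lerN2 ltW.
Qed.

(** The derivative of (1 + iv) e^(-iv) is v e^(-iv), of modulus |v|; the mean value theorem is
    applied to real and imaginary parts. *)
Lemma expmi_approx v : normc ((1 +i* v)^-1 - expmi v) <= 2 * v ^+ 2.
Proof.
have n1 : 1 <= normc (1 +i* v).
  by have := Re_le_normc (1 +i* v); rewrite /= normr1.
have z0 : 1 +i* v != 0 by rewrite -normc_gt0 (lt_le_trans _ n1).
have -> : (1 +i* v)^-1 - expmi v = (1 - (1 +i* v) * expmi v) / (1 +i* v) by field.
rewrite normcM normcV ler_pdivrMr ?(lt_le_trans _ n1) //.
apply: (@le_trans _ _ (2 * v ^+ 2)); last by rewrite ler_peMr // mulr_ge0 ?sqr_ge0.
have H1 : `|cos v + v * sin v - (cos 0 + 0 * sin 0)| <= v ^+ 2.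
  apply: (@sqr_bound_of_derive (fun x => cos x + x * sin x) (fun x => x * cos x)) => x.
    by apply: is_derive_eq; rewrite /GRing.scale /=; ring.
  by rewrite normrM ler_piMr // ler_norml cos_geN1 cos_le1.
have H2 : `|v * cos v - sin v - (0 * cos 0 - sin 0)| <= v ^+ 2.
  apply: (@sqr_bound_of_derive (fun x => x * cos x - sin x) (fun x => - x * sin x)) => x.
    by apply: is_derive_eq; rewrite /GRing.scale /=; ring.
  by rewrite normrM normrN ler_piMr // ler_norml sin_geN1 sin_le1.
apply: le_trans (normc_le_ReIm _) _.
rewrite mulr_natl mulr2n; apply: lerD.
  apply: le_trans H1; rewrite cos0 mul0r addr0 distrC le_eqVlt; apply/orP; left.
  by apply/eqP; congr `|_|; rewrite /=; ring.
apply: le_trans H2; rewrite sin0 mul0r subr0 -normrN le_eqVlt; apply/orP; left.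
by apply/eqP; congr `|_|; rewrite /=; ring.
Qed.

Lemma normc_subrXX a b K : normc a <= 1 -> normc b <= 1 ->
  normc (a ^+ K - b ^+ K) <= K%:R * normc (a - b).
Proof.
move=> a1 b1; rewrite subrXX normcM mulrC ler_wpM2r ?normc_ge0 //.
apply: le_trans (normc_sum _ _ _) _.
apply: (@le_trans _ _ (\sum_(i < K) 1)); last by rewrite sumr_const card_ord.
apply: ler_sum => i _.
by rewrite normcM !normcX mulr_ile1 ?exprn_ge0 ?normc_ge0 // exprn_ile1 ?normc_ge0.
Qed.

Lemma normc_inv1i v : normc (1 +i* v)^-1 <= 1.
Proof.
rewrite normcV invf_le1; have := Re_le_normc (1 +i* v); rewrite /= normr1 //.
exact: lt_le_trans.
Qed.

Lemma resolvent_imaginary Y x : 0 < Y ->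
  (0 +i* Y - x%:C)^-1 = (0 +i* Y)^-1 * (1 +i* (x / Y))^-1.
Proof.
move=> Y0; rewrite -invfM; congr (_^-1).
by apply/eqP; rewrite eq_complex /=; apply/andP; split; apply/eqP; field; rewrite gt_eqF.
Qed.

(* Post-Widder: with K = t Y the K-th power of Y/(Y + i x) tends to e^(-itx). *)
Lemma post_widder_approx mu Y t K : rintegrable mu (fun x => x ^+ 2) ->
  0 < Y -> K%:R = t * Y ->
  normc ((0 +i* Y) ^+ K * complex_integral mu (fun x => (0 +i* Y - x%:C)^-1 ^+ K) -
         char_fun mu (- t)) <= 4 * t * moment mu 2 / Y.
Proof.
move=> mu2 Y0 KE; have Yi0 : 0 +i* Y != 0.
  by rewrite -normc_gt0 normc_imaginary // ltW.
have iR := @cintegrable_resolventX R mu (0 +i* Y) K Y0.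
have mC : cmeasurable (fun x => cos (- t * x) +i* sin (- t * x)).
  have mt : measurable_fun [set: measurableTypeR R] (fun x => - t * x).
    by apply: measurable_funM; [exact: measurable_cst|exact: measurable_id].
  split => /=.
    by apply: (measurableT_comp _ mt); apply: continuous_measurable_fun; exact: continuous_cos.
  by apply: (measurableT_comp _ mt); apply: continuous_measurable_fun; exact: continuous_sin.
have cE x : cos (- t * x) +i* sin (- t * x) = expmi (t * x).
  by rewrite /expmi mulNr cosN sinN.
have iC : cintegrable mu (fun x => cos (- t * x) +i* sin (- t * x)).
  by apply: cintegrable_bounded mC _ => x; rewrite cE normc_expmi.
have iB : cintegrable mu (fun x => (0 +i* Y) ^+ K * (0 +i* Y - x%:C)^-1 ^+ K -
    (cos (- t * x) +i* sin (- t * x))).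
  by apply: cintegrableB => //; exact: cintegrableZ.
rewrite /char_fun -cintegralZ // -cintegralB //; last exact: cintegrableZ.
have -> : 4 * t * moment mu 2 / Y = 2 * \int[mu]_x (2 * K%:R / Y ^+ 2 * x ^+ 2).
  rewrite RintegralZl // -/(moment mu 2) KE.
  by field; rewrite gt_eqF.
apply: normc_cintegral_le => //; first exact: rintegrableZ.
(* The kernel is (1 + ix/Y)^(-K) and e^(-itx) is the K-th power of e^(-ix/Y). Both bases have
   modulus at most 1, so the error is at most K times 2 (x/Y)^2. *)
move=> x; rewrite cE resolvent_imaginary // exprMn mulrA -exprMn divff // expr1n mul1r.
have -> : t * x = K%:R * (x / Y) by rewrite KE; field; rewrite gt_eqF.
rewrite -expmiX; apply: le_trans (normc_subrXX _ _ _) _.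
- exact: normc_inv1i.
- by rewrite normc_expmi.
apply: le_trans (ler_wpM2l (ler0n _ _) (expmi_approx _)) _.
by rewrite le_eqVlt; apply/orP; left; apply/eqP; field; rewrite gt_eqF.
Qed.

(** Cauchy's estimate for a Taylor polynomial of G_mu - G_rho at Z, cut so late that its remainder
    is below any given [d]. *)
Lemma cauchy_taylor_diff mu rho (Z : R[i]) r e k : 0 < complex.Im Z -> 0 < r ->
  r <= complex.Im Z / 2 ->
  (forall h, normc h = r ->
    normc (cauchy_transform mu (Z + h) - cauchy_transform rho (Z + h)) <= e) ->
  normc (complex_integral mu (fun x => (Z - x%:C)^-1 ^+ k.+1) -
         complex_integral rho (fun x => (Z - x%:C)^-1 ^+ k.+1)) * r ^+ k <= e.
Proof.
move=> Z0 r0 rZ He; apply/ler_addgt0Pr => d d0.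
have dZ : 0 < d / (8 / complex.Im Z) by rewrite !divr_gt0.
have [n nP] := geometric_small dZ.
pose c i := complex_integral mu (fun x => (Z - x%:C)^-1 ^+ i.+1) -
            complex_integral rho (fun x => (Z - x%:C)^-1 ^+ i.+1).
(* At least k + 1 terms, so that the k-th coefficient is present, and at least n, so that each
   remainder is at most d/2. *)
pose N := maxn n k.+1.
pose p := \poly_(i < N) ((-1) ^+ i * c i).
have := @coef_le_circle R p r (e + d) r0 _ k.
rewrite coef_poly leq_max leqnn orbT normcM normcX normcN normc1 expr1n mul1r; apply.
move=> h hr; rewrite horner_poly.
have hZ : normc h <= complex.Im Z / 2 by rewrite hr.
have E1 := cauchy_expansion mu N Z0 hZ; have E2 := cauchy_expansion rho N Z0 hZ.
move: E1 E2; set S1 := \sum_(i < N) _; set S2 := \sum_(i < N) _ => E1 E2.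
have -> : \sum_(i < N) (-1) ^+ i * c i * h ^+ i = S1 - S2.
  rewrite -sumrB; apply: eq_bigr => i _; rewrite -mulrBr mulrAC; congr (_ * _).
  by rewrite -exprMn mulN1r.
have NP : 2^-1 ^+ N * (4 / complex.Im Z) <= d / 2.
  have h1 : 2^-1 ^+ N <= (2^-1 : R) ^+ n.
    by rewrite ler_wiXn2l ?invr_ge0 ?invf_le1 ?ler1n // leq_maxl.
  have : 2^-1 ^+ N * (8 / complex.Im Z) <= d.
    by rewrite -ler_pdivlMr ?divr_gt0 //; exact: le_trans h1 nP.
  have -> : 8 / complex.Im Z = 2 * (4 / complex.Im Z) by ring.
  by set u := 4 / complex.Im Z; lra.
have -> : S1 - S2 = (cauchy_transform mu (Z + h) - cauchy_transform rho (Z + h)) -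
  (cauchy_transform mu (Z + h) - S1) + (cauchy_transform rho (Z + h) - S2) by ring.
apply: le_trans (normcD _ _) _.
have := normcB (cauchy_transform mu (Z + h) - cauchy_transform rho (Z + h))
  (cauchy_transform mu (Z + h) - S1).
by have := He h hr; lra.
Qed.

End ExponentialKernel.

(** * From the liminf to exponentially close powers *)

Section Frequently.
Context {R : realType}.

Lemma frequently_lt_limn_einf (u : nat -> \bar R) (b : \bar R) :
  (limn_einf u < b)%E -> forall N, exists2 n, (N <= n)%N & (u n < b)%E.
Proof.
move=> ub N; apply: contrapT => H; move: ub; apply/negP; rewrite -leNgt.
rewrite limn_einf_lim (cvg_lim _ (@cvg_einfs_sup _ u)) //.
apply: (@le_trans _ _ (einfs u N)); last by apply: ereal_sup_ubound; exists N.
apply: le_ereal_inf_tmp => _ [n /= Nn <-]; rewrite leNgt; apply/negP => un.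
by apply: H; exists n.
Qed.

Lemma kolmogorov_frequently (mupow rhopow : nat -> borel_prob R) (beta : R) :
  0 < beta ->
  limn_einf (fun n : nat =>
    (lne (kolmogorov (mupow n) (rhopow n)) * ((Num.sqrt n%:R)^-1)%:E)%E) = (- beta)%:E ->
  forall N, exists2 n, (N <= n)%N &
    cdf_close (mupow n) (rhopow n) (expR (- (beta / 2 * Num.sqrt n%:R))).
Proof.
move=> b0 lim N.
have bb : ((- beta)%:E < (- (beta / 2))%:E)%E.
  by rewrite lte_fin ltrN2 ltr_pdivrMr // ltr_pMr // ltr1n.
(* Asking for n > N makes n positive, so that the division by sqrt n is genuine. *)
rewrite -lim in bb; have [n Nn] := frequently_lt_limn_einf bb N.+1.
have s0 : 0 < Num.sqrt n%:R :> R by rewrite sqrtr_gt0 ltr0n (leq_trans _ Nn).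
move=> H; exists n; first exact: ltnW.
apply: kolmogorov_close; move: H; case: (kolmogorov _ _) => [r| |] //=.
  (* At distance 0 the logarithm is -oo and the bound is immediate. *)
  case: ifPn => [r0 _|]; first by rewrite lee_fin (le_trans r0) ?expR_ge0.
  rewrite -ltNge => r0; rewrite -EFinM lte_fin ltr_pdivrMr // => H.
  by rewrite lee_fin -(lnK r0) ler_expR ltW // -mulNr.
  by rewrite mulyr gtr0_sg ?invr_gt0 // mul1e.
by rewrite leNye.
Qed.

End Frequently.

(** * Choice of the parameters and conclusion *)

Section Main.
Context {R : realType}.
Implicit Types (mu rho : borel_prob R) (t : R).

Lemma rintegrable_sqr_of_moment mu d : (2 <= d)%N ->
  (\int[mu]_x (`|x| ^+ d)%:E < +oo)%E -> rintegrable mu (fun x => x ^+ 2).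
Proof.
move=> d2 md; have mX k : measurable_fun [set: measurableTypeR R] (fun x => x ^+ k).
  by apply: measurable_funX; exact: measurable_id.
have i1 : rintegrable mu (fun x => `|x| ^+ d).
  apply/integrableP; split.
    apply/measurable_EFinP; apply: measurable_funX; exact: normr_measurable.
  by under eq_integral do rewrite /= ger0_norm ?exprn_ge0 //.
apply: (@le_rintegrable _ _ _ (fun x => 1 + `|x| ^+ d)); first exact: mX.
  move=> x; rewrite normrX; case: (lerP `|x| 1) => x1.
    by apply: (@le_trans _ _ 1); rewrite ?exprn_ile1 // lerDl exprn_ge0.
  by apply: (@le_trans _ _ (`|x| ^+ d)); [rewrite ler_weXn2l // ltW|rewrite lerDr].
by apply: rintegrableD => //; exact: rintegrable_cst.
Qed.

Lemma moment2_ge0 mu : 0 <= moment mu 2.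
Proof. by apply: Rintegral_ge0 => x _; exact: sqr_ge0. Qed.

(** The circle of radius Y/2 about iY descends to height Y/2, which turns 100 into 400 and 600 into
    1200. On it |Z - m| <= 2Y <= 4 Im Z, by the condition on the mean. *)
Lemma char_fun_diff_bound mu rho lam lam' (n k : nat) (t delta Y : R)
    (s2 := moment mu 2 - moment mu 1 ^+ 2) :
  rintegrable mu (fun x => x ^+ 2) -> rintegrable rho (fun x => x ^+ 2) ->
  is_free_power mu n.+2 lam -> is_free_power rho n.+2 lam' ->
  cdf_close lam lam' delta -> delta <= 100^-1 ->
  0 < Y -> k.+1%:R = t * Y -> 400 * n.+2%:R * s2 <= Y ^+ 2 -> 2 * `|moment mu 1| <= Y ->
  normc (char_fun mu (- t) - char_fun rho (- t)) <=
    4 * t * (moment mu 2 + moment rho 2) / Y + 1200 * (2 ^+ k * delta).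
Proof.
move=> mu2 rho2 pw pw' close d100 Y0 kY hY mY.
have d0 := cdf_close_ge0 close.
have G h : normc h = Y / 2 -> normc (cauchy_transform mu (0 +i* Y + h) -
    cauchy_transform rho (0 +i* Y + h)) <= 1200 * delta / Y.
  move=> hh; have Iy : Y / 2 <= complex.Im (0 +i* Y + h).
    by apply: (@Im_gt0_near R (0 +i* Y) h Y0); rewrite hh.
  have y0 : 0 < complex.Im (0 +i* Y + h) by apply: lt_le_trans Iy; rewrite divr_gt0.
  apply: (le_trans (cauchy_close_of_free_powers mu2 (free_power_subordination pw)
    (free_power_subordination pw') close d100 y0 _ _)).
  - rewrite -/s2; apply: (@le_trans _ _ ((Y / 2) ^+ 2)); last first.
      by rewrite lerXn2r // nnegrE ltW // divr_gt0.
    have -> : 100 * n.+2%:R * s2 = 400 * n.+2%:R * s2 / 4 by field.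
    have -> : (Y / 2) ^+ 2 = Y ^+ 2 / 4 by field.
    by rewrite ler_wpM2r // invr_ge0.
  - apply: le_trans (normcB _ _) _; rewrite normc_real.
    apply: le_trans (lerD (normcD _ _) (lexx _)) _.
    by rewrite hh normc_imaginary ?(ltW Y0) //; lra.
  have -> : 1200 * delta / Y = 600 * delta * (2 / Y) by ring.
  apply: ler_wpM2l; first exact: mulr_ge0 (ler0n _ _) d0.
  by rewrite -invf_div lef_pV2 ?posrE ?divr_gt0.
have Y2 : 0 < Y / 2 by rewrite divr_gt0.
have T := @cauchy_taylor_diff _ mu rho (0 +i* Y) (Y / 2) _ k Y0 Y2 (lexx _) G.
have P1 := post_widder_approx mu2 Y0 kY; have P2 := post_widder_approx rho2 Y0 kY.
move: T P1 P2; set I1 := complex_integral mu _; set I2 := complex_integral rho _ => T P1 P2.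
(* Cauchy's estimate has radius Y/2 where the kernel has Y: the price is 2^k. *)
have ID : normc ((0 +i* Y) ^+ k.+1 * I1 - (0 +i* Y) ^+ k.+1 * I2) <= 1200 * (2 ^+ k * delta).
  rewrite -mulrBr normcM normcX normc_imaginary ?(ltW Y0) //.
  have -> : Y ^+ k.+1 * normc (I1 - I2) = Y * 2 ^+ k * (normc (I1 - I2) * (Y / 2) ^+ k).
    by rewrite exprMn exprVn exprS; field; rewrite expf_neq0.
  apply: le_trans (ler_wpM2l _ T) _; first by rewrite mulr_ge0 ?exprn_ge0 // ltW.
  by rewrite le_eqVlt; apply/orP; left; apply/eqP; field; rewrite gt_eqF.
move: ((0 +i* Y) ^+ k.+1 * I1) ((0 +i* Y) ^+ k.+1 * I2) P1 P2 ID => Q1 Q2 P1 P2 ID.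
apply: le_trans (normc_triangle Q1 _ _) _.
apply: le_trans (lerD (lexx _) (normc_triangle Q2 _ _)) _.
rewrite [normc (_ - Q1)]normcC.
have -> : 4 * t * (moment mu 2 + moment rho 2) / Y =
  4 * t * moment mu 2 / Y + 4 * t * moment rho 2 / Y by ring.
apply: le_trans (lerD P1 (lerD ID P2)) _.
by rewrite addrCA addrC -addrA.
Qed.

Lemma char_funN mu t : char_fun mu (- t) = (char_fun mu t)^*%C.
Proof.
rewrite /char_fun /complex_integral /=; congr (_ +i* _).
  by apply: eq_Rintegral => x _; rewrite mulNr cosN.
have ms : measurable_fun [set: measurableTypeR R] (fun x => sin (t * x)).
  apply: (measurableT_comp (f := sin)); first by apply: continuous_measurable_fun; exact: continuous_sin.
  by apply: measurable_funM; [exact: measurable_cst|exact: measurable_id].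
rewrite -mulN1r -RintegralZl //.
  by apply: eq_Rintegral => x _; rewrite mulNr sinN mulN1r.
apply: (@bounded_rintegrable _ _ _ 1) => // x.
by rewrite ler_norml sin_geN1 sin_le1.
Qed.

Lemma exp2_le_expR k : 2 ^+ k <= expR k%:R :> R.
Proof.
rewrite -[k%:R]mulr1 expRM_natl lerXn2r ?nnegrE ?expR_ge0 //.
by have := expR_ge1Dx (1 : R).
Qed.

Lemma expRN_le (x : R) : 0 < x -> expR (- x) <= x^-1.
Proof.
move=> x0; rewrite expRN lef_pV2 ?posrE ?expR_gt0 //.
by apply: le_trans (expR_ge1Dx x); rewrite lerDr.
Qed.

Lemma char_fun_eq_pos mu rho (mupow rhopow : nat -> borel_prob R) (beta t : R)
    (s := Num.sqrt (moment mu 2 - moment mu 1 ^+ 2)) :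
  rintegrable mu (fun x => x ^+ 2) -> rintegrable rho (fun x => x ^+ 2) ->
  (forall n : nat, (0 < n)%N -> is_free_power mu n (mupow n)) ->
  (forall n : nat, (0 < n)%N -> is_free_power rho n (rhopow n)) ->
  0 < beta ->
  (forall N, exists2 n, (N <= n)%N &
    cdf_close (mupow n) (rhopow n) (expR (- (beta / 2 * Num.sqrt n%:R)))) ->
  0 < s -> 0 < t -> t <= beta / (300 * s) ->
  char_fun mu (- t) = char_fun rho (- t).
Proof.
move=> mu2 rho2 pw pw' b0 freq s0 t0 tb.
apply/eqP; rewrite -subr_eq0 -normc_eq0 eq_le normc_ge0 andbT.
apply/ler_addgt0Pr => e e0; rewrite add0r.
have M0 : 0 <= moment mu 2 + moment rho 2 by rewrite addr_ge0 ?moment2_ge0.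
set M := _ + _ in M0.
have s2 : s ^+ 2 = moment mu 2 - moment mu 1 ^+ 2 by rewrite sqr_sqrtr // variance_ge0.
have [c cE] : exists c : R, c = 1200 by exists 1200.
have c0 : 0 <= c by rewrite cE ler0n.
(* The final bound is C / sqrt n: the first term is the Post-Widder error with Y >= 20 s sqrt n, the
   second comes from exp(- beta sqrt n / 4) <= 4 / (beta sqrt n). *)
pose C := t * M / (5 * s) + c * (4 / beta).
have C0 : 0 <= C.
  by apply: addr_ge0; [rewrite divr_ge0 ?mulr_ge0 // ltW|rewrite mulr_ge0 ?divr_ge0 // ltW].
(* B bounds sqrt n from below. The four conditions give in turn n >= 2, [delta] <= 1/100, a final
   bound of at most [e], and 2 |m| <= Y. *)
have [B [B2 Bb Be Bm]] : exists B : R, [/\ 2 <= B, 200 <= beta * B, C <= e * B &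
    `|moment mu 1| <= 10 * s * B].
  have B1 : 0 <= `|moment mu 1| / (10 * s) by rewrite divr_ge0 ?mulr_ge0 // ltW.
  have B2 : 0 <= 200 / beta by apply: divr_ge0 (ltW b0); exact: ler0n.
  have B3 : 0 <= C / e by rewrite divr_ge0 // ltW.
  exists (2 + (`|moment mu 1| / (10 * s) + (200 / beta + C / e))); split.
  - by rewrite lerDl !addr_ge0.
  - by rewrite -ler_pdivrMl // [_^-1 * _]mulrC ler_wpDl // ler_wpDl // lerDl.
  - by rewrite -ler_pdivrMl // [_^-1 * _]mulrC ler_wpDl // ler_wpDl // lerDr.
  - by rewrite -ler_pdivrMl ?mulr_gt0 // [_^-1 * _]mulrC ler_wpDl // lerDl addr_ge0.
have B0 : 0 < B by apply: lt_le_trans B2.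
have [n Nn close] := freq (Num.truncn (B ^+ 2)).+1.
set q := Num.sqrt n%:R in close.
have qB : B <= q.
  rewrite -[leLHS](gtr0_norm B0) -sqrtr_sqr ler_wsqrtr //.
  have /andP[_ /ltW] := truncn_itv (sqr_ge0 B).
  by move=> /le_trans; apply; rewrite ler_nat.
have qq : q ^+ 2 = n%:R by rewrite sqr_sqrtr.
have q0 : 0 < q by exact: lt_le_trans qB.
have n1 : (1 < n)%N.
  rewrite -(ltr_nat R) -qq expr2; apply: (@lt_le_trans _ _ (2 * 2)); first by rewrite -natrM ltr_nat.
  by rewrite ler_pM // (le_trans B2).
have [n' nE] : exists n', n = n'.+2.
  by case: n n1 {Nn close q qB qq q0} => [//|[//|n]] _; exists n.
have n0 : (0 < n)%N by exact: ltnW.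
have pw1 := pw _ n0; have pw2 := pw' _ n0; rewrite {1}nE in pw1; rewrite {1}nE in pw2.
have x0 : 0 <= 20 * s * q * t by rewrite !mulr_ge0 // ltW.
pose k := Num.truncn (20 * s * q * t).
have /andP[k1 k2] := truncn_itv x0; rewrite -/k in k1 k2.
(* Rounding k first and then setting Y makes k + 1 = tY exact while keeping Y >= 20 s sqrt n. *)
pose Y := k.+1%:R / t.
have Y0 : 0 < Y by rewrite divr_gt0.
have kY : k.+1%:R = t * Y by rewrite /Y mulrC divfK // gt_eqF.
have Yq : 20 * s * q <= Y by rewrite /Y ler_pdivlMr // ltW.
have sq0 : 0 < s * q by rewrite mulr_gt0.
have bq : beta * B <= beta * q by rewrite ler_wpM2l // ltW.
clearbody s q Y k.
have dl : expR (- (beta / 2 * q)) <= 100^-1.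
  apply: le_trans (expRN_le _) _; first by rewrite !mulr_gt0.
  rewrite lef_pV2 ?posrE ?mulr_gt0 //; clear - bq Bb; lra.
have h1 : 400 * n'.+2%:R * (moment mu 2 - moment mu 1 ^+ 2) <= Y ^+ 2.
  rewrite -nE -qq -s2.
  have -> : 400 * q ^+ 2 * s ^+ 2 = (20 * s * q) ^+ 2 by ring.
  by rewrite lerXn2r // ?nnegrE ?(ltW Y0) // !mulr_ge0 // ltW.
have h2 : 2 * `|moment mu 1| <= Y.
  apply: le_trans Yq; have : 10 * s * B <= 10 * s * q by rewrite ler_wpM2l // mulr_ge0 // ltW.
  by move: Bm; clear; lra.
have main := char_fun_diff_bound mu2 rho2 pw1 pw2 close dl Y0 kY h1 h2.
rewrite -cE -/M in main.
have P1 : 4 * t * M / Y <= t * M / (5 * s) / q.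
  have -> : t * M / (5 * s) / q = 4 * t * M / (20 * s * q) by field; rewrite !gt_eqF.
  by rewrite ler_wpM2l ?mulr_ge0 ?(ltW t0) // lef_pV2 ?posrE // !mulr_gt0.
(* 20 s t <= 20 beta / 300 = beta / 15, well below the beta / 4 that the next step can afford. *)
have kb : k%:R <= beta * q / 15.
  have s300 : 0 < 300 * s by apply: mulr_gt0 s0; exact: ltr0Sn.
  apply: le_trans k1 _; move: tb; rewrite ler_pdivlMr {s300}// => tb.
  by have := ler_wpM2r (ltW q0) tb; clear; lra.
have P2 : 2 ^+ k * expR (- (beta / 2 * q)) <= 4 / beta / q.
  apply: (@le_trans _ _ (expR (- (beta / 4 * q)))).
    apply: (@le_trans _ _ (expR (k%:R) * expR (- (beta / 2 * q)))).
      by rewrite ler_wpM2r ?expR_ge0 // exp2_le_expR.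
    rewrite -expRD ler_expR; have : 0 < beta * q by rewrite mulr_gt0.
    by clear - kb; lra.
  apply: le_trans (expRN_le _) _; first by rewrite !mulr_gt0.
  by rewrite invfM invf_div.
apply: (le_trans main); apply: (@le_trans _ _ (C / q)).
  have -> : C / q = t * M / (5 * s) / q + c * (4 / beta / q).
    by rewrite /C [LHS]mulrDl; congr (_ + _); rewrite [RHS]mulrA.
  by apply: lerD P1 _; exact: ler_wpM2l.
by rewrite ler_pdivrMr //; apply: le_trans Be _; rewrite ler_wpM2l // ltW.
Qed.

End Main.

Theorem corollary2p7 (R : realType) (d : nat) (mu rho : borel_prob R)
    (mupow rhopow : nat -> borel_prob R) (beta : R)
    (hd : (3 <= d)%N)
    (hmu : (\int[mu]_x (`|x| ^+ d)%:E < +oo)%E)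
    (hrho : (\int[rho]_x (`|x| ^+ d)%:E < +oo)%E)
    (hmupow : forall n : nat, (0 < n)%N -> is_free_power mu n (mupow n))
    (hrhopow : forall n : nat, (0 < n)%N -> is_free_power rho n (rhopow n))
    (hbeta : 0 < beta)
    (hliminf : limn_einf (fun n : nat =>
        (lne (kolmogorov (mupow n) (rhopow n)) * ((Num.sqrt n%:R)^-1)%:E)%E)
      = (- beta)%:E) :
  let r := beta / (300 * Num.sqrt (moment mu 2 - moment mu 1 ^+ 2)) in
  forall t : R, - r <= t <= r -> char_fun mu t = char_fun rho t.
Proof.
move=> r t /andP[rt tr].
have d2 : (2 <= d)%N by exact: ltnW.
have mu2 := rintegrable_sqr_of_moment d2 hmu; have rho2 := rintegrable_sqr_of_moment d2 hrho.
have freq := kolmogorov_frequently hbeta hliminf.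
have conj_inj (a b : R[i]) : (a^*)%C = (b^*)%C -> a = b.
  by move=> ab; rewrite -[a]conjcK ab conjcK.
have pos u : 0 < u -> u <= r -> char_fun mu (- u) = char_fun rho (- u).
  move=> u0 ur; apply: (char_fun_eq_pos mu2 rho2 hmupow hrhopow hbeta freq _ u0 ur).
  (* For zero variance, division by 0 yields 0, so r = 0 and no u satisfies 0 < u <= r. *)
  rewrite lt_neqAle sqrtr_ge0 andbT; apply/eqP => s0; move: (lt_le_trans u0 ur).
  by rewrite /r -s0 mulr0 invr0 mulr0 ltxx.
have [t0|t0|<-] := ltgtP 0 t.
- by apply: conj_inj; rewrite -!char_funN pos.
- by rewrite -[t]opprK pos ?oppr_gt0 // lerNl.
have E (m : borel_prob R) : char_fun m 0 = 1.
  rewrite -[RHS](cintegral_cst m); apply: eq_cintegral => x.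
  by rewrite mul0r cos0 sin0.
by rewrite !E.
Qed.
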